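(* Let $a\ge 1$ and $b\ge 0$ be integers such that either (1) $a+b$ is odd and $(a,b)\neq(2,1)$, or (2) $a$ is even and $b$ is divisible by $4$. Let $n=2a+b+1$, let $G=\mathfrak{S}_n$ in case (1) and $G=A_n$ in case (2), and let $S_1,S_2\subset G$ be the sets attached to $\theta_{a,b}$ defined in the context. Then the Cayley graph $X(G,S_1)$ is not isomorphic to the Cayley graph $X(G,S_2)$.
   Context: Theta graph. For integers $a\ge1$, $b\ge0$ put $n=2a+b+1$. The graph $\theta_{a,b}$ is the undirected simple graph with vertex set $V=\{v_0,\dots,v_n\}$ and edges $\{v_i,v_{i+1}\}$ for $i\in\{0,1,\dots,n-1\}\setminus\{2a+1\}$, together with $\{v_0,v_{2a+1}\}$, $\{v_0,v_{2a+2}\}$ and $\{v_{2a+b+1},v_{a+1}\}$; when $b=0$ the last two edges are replaced by the single edge $\{v_0,v_{a+1}\}$. Involutions. $\rho:V\to V$ is given by $\rho(v_i)=v_{(i+a+1)\bmod(2a+2)}$ for $0\le i\le 2a+1$ and $\rho(v_i)=v_{4a+b+3-i}$ for $2a+2\le i\le 2a+b+1$. $\psi:V\to V$ is given by $\psi(v_i)=v_{a+1-i}$ for $0\le i\le a+1$, $\psi(v_i)=v_{3a+3-i}$ for $a+2\le i\le 2a+1$, and $\psi(v_i)=v_{4a+b+3-i}$ for $2a+2\le i\le 2a+b+1$. Generating sets. Permutations are composed as functions (right to left). For a path $p=(w_0,w_1,\dots,w_l)$ in $\theta_{a,b}$ let $\sigma_p=(w_0,w_1)(w_1,w_2)\cdots(w_{l-1},w_l)$,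 a product of transpositions of $V$. Let $p_1=(v_0,v_1,\dots,v_{a+1})$, $p_2=(v_0,v_{2a+2},\dots,v_{2a+b+1},v_{a+1})$ (which is $(v_0,v_{a+1})$ if $b=0$), $p_3=(v_0,v_{2a+1},v_{2a},\dots,v_{a+1})$. The permutations $\sigma_{p_k}\rho$ and $\sigma_{p_k}\psi$ of $V$ fix $v_0$; define $\sigma_k,\tau_k\in\mathfrak{S}_n$ by $\sigma_{p_k}\rho(v_i)=v_{\sigma_k(i)}$ and $\sigma_{p_k}\psi(v_i)=v_{\tau_k(i)}$ for $i=1,\dots,n$, $k=1,2,3$. Put $S_1=\{\sigma_1,\sigma_2,\sigma_3\}$, $S_2=\{\tau_1,\tau_2,\tau_3\}$. Under the stated hypotheses on $(a,b)$, $S_1,S_2\subset G$. Cayley graphs. For a finite group $G$ and $S\subset G$, $X(G,S)=\mathtt{Cay}(G,S)$ is the directed graph with vertex set $G$ and an edge from $g$ to $h$ iff $h=gk$ for some $k\in S$. Isomorphism means isomorphism of directed graphs. *)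

(* Defs.v *)
From mathcomp Require Import all_boot all_fingroup all_solvable.
From mathcomp Require Import zify.

Set Implicit Arguments.
Unset Strict Implicit.
Unset Printing Implicit Defensive.

Section Perms.

Variable T : finType.

(* Right-to-left composition: the group law of {perm T} in the library composes
   left to right, [(s * t) x = t (s x)]. *)
Definition pcomp (s t : {perm T}) : {perm T} := (t * s)%g.

Lemma pcompE s t x : pcomp s t x = s (t x).
Proof. exact: permM. Qed.

(* [(w_0, w_1) (w_1, w_2) ... (w_{l-1}, w_l)] for [p = [:: w_0; ...; w_l]]. *)
Fixpoint path_perm (p : seq T) : {perm T} :=
  if p is x :: q then
    if q is y :: _ then pcomp (tperm x y) (path_perm q) else 1%g
  else 1%g.

Lemma path_perm_last x q : path_perm (x :: q) (last x q) = x.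
Proof.
elim: q x => [|y q IHq] x; first exact: perm1.
by rewrite [path_perm _]/(pcomp _ (path_perm (y :: q))) pcompE IHq tpermR.
Qed.

(* Directed Cayley graph for the law [pcomp]: an edge from [g] to [h] iff
   [h] is [g] after [k] for some [k] in [S]. *)
Definition cayley (G : {group {perm T}}) (S : {set {perm T}}) : rel [subg G] :=
  fun g h => [exists k in S, sgval h == pcomp (sgval g) k].

End Perms.

Arguments cayley {T} G S.

Definition digraph_iso (T U : finType) (e : rel T) (e' : rel U) : Prop :=
  exists2 f : T -> U, bijective f & forall x y, e' (f x) (f y) = e x y.

Section FixZero.

Variables (n : nat) (g : {perm 'I_n.+1}).

Fact fix0_key j : unlift (g ord0) (g (lift ord0 j)).
Proof.
case: unliftP => // /perm_inj e.
by have /eqP := neq_lift ord0 j; rewrite e.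
Qed.

Definition fix0_fun (j : 'I_n) : 'I_n :=
  odflt j (unlift (g ord0) (g (lift ord0 j))).

Lemma lift_fix0_fun j : lift (g ord0) (fix0_fun j) = g (lift ord0 j).
Proof. by rewrite /fix0_fun; have := fix0_key j; case: unliftP. Qed.

Fact fix0_fun_inj : injective fix0_fun.
Proof.
move=> i j e; apply/(@lift_inj _ ord0)/(@perm_inj _ g).
by rewrite -!lift_fix0_fun e.
Qed.

(* For [g] fixing [ord0]: its restriction to the indices 1, ..., n, where
   [j : 'I_n] encodes the index [j + 1], i.e. [lift ord0 j] in ['I_n.+1]. *)
Definition fix0_perm : 'S_n := perm fix0_fun_inj.

Lemma fix0_permP : g ord0 = ord0 ->
  forall j, g (lift ord0 j) = lift ord0 (fix0_perm j).
Proof. by move=> g0 j; rewrite permE -lift_fix0_fun g0. Qed.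

End FixZero.

Section Theta.

Variables a b : nat.

Definition theta_n := 2 * a + b + 1.

Local Notation n := theta_n.

(* The vertex [v_i] is the ordinal [i : 'I_n.+1]. *)
Local Notation V := 'I_n.+1.

Definition theta_arc (i j : nat) : bool :=
  [|| (j == i.+1) && (i != 2 * a + 1),
      (i == 0) && (j == 2 * a + 1)
    | if b == 0 then (i == 0) && (j == a + 1)
      else (i == 0) && (j == 2 * a + 2)
           || (i == 2 * a + b + 1) && (j == a + 1)].

Definition theta_edge : rel V := fun u v => theta_arc u v || theta_arc v u.

Definition rho_nat (i : nat) : nat :=
  if i <= 2 * a + 1 then (i + a + 1) %% (2 * a + 2) else 4 * a + b + 3 - i.

Definition psi_nat (i : nat) : nat :=
  if i <= a + 1 then a + 1 - i
  else if i <= 2 * a + 1 then 3 * a + 3 - i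
  else 4 * a + b + 3 - i.

Definition rho_fun (v : V) : V := inord (rho_nat v).
Definition psi_fun (v : V) : V := inord (psi_nat v).

Fact rho_nat_le i : i <= n -> rho_nat i <= n.
Proof. rewrite /rho_nat /n; case: ifP; lia. Qed.

Fact psi_nat_le i : i <= n -> psi_nat i <= n.
Proof. rewrite /psi_nat /n; do 2?case: ifP; lia. Qed.

Fact rho_natK i : i <= n -> rho_nat (rho_nat i) = i.
Proof.
rewrite /n => le_in; rewrite {2}/rho_nat; case: ifP => le_i; last first.
  by rewrite /rho_nat ifF; lia.
rewrite /rho_nat ifT; last by lia.
have [lt_i | ge_i] := ltnP i (a + 1).
  rewrite (@modn_small (i + a + 1)); last by lia.
  have -> : i + a + 1 + a + 1 = i + (2 * a + 2) by lia.
  by rewrite modnDr modn_small; lia.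
have -> : i + a + 1 = i - (a + 1) + (2 * a + 2) by lia.
by rewrite modnDr (@modn_small (i - _)) ?modn_small; lia.
Qed.

Fact psi_natK i : i <= n -> psi_nat (psi_nat i) = i.
Proof. by rewrite /psi_nat /n => le_in; repeat case: ifP; lia. Qed.

Lemma rho_funE (v : V) : rho_fun v = rho_nat v :> nat.
Proof. by rewrite inordK // ltnS rho_nat_le // -ltnS. Qed.

Lemma psi_funE (v : V) : psi_fun v = psi_nat v :> nat.
Proof. by rewrite inordK // ltnS psi_nat_le // -ltnS. Qed.

Fact rho_funK : involutive rho_fun.
Proof.
by move=> v; apply: val_inj; rewrite /= !rho_funE rho_natK // -ltnS.
Qed.

Fact psi_funK : involutive psi_fun.
Proof.
by move=> v; apply: val_inj; rewrite /= !psi_funE psi_natK // -ltnS.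
Qed.

Definition rho : {perm V} := perm (inv_inj rho_funK).
Definition psi : {perm V} := perm (inv_inj psi_funK).

Definition theta_p1 : seq V := map inord (iota 0 (a + 2)).
Definition theta_p2 : seq V :=
  map inord (0 :: rcons (iota (2 * a + 2) b) (a + 1)).
Definition theta_p3 : seq V := map inord (0 :: rev (iota (a + 1) (a + 1))).

Definition theta_sigma (p : seq V) : 'S_n := fix0_perm (pcomp (path_perm p) rho).
Definition theta_tau (p : seq V) : 'S_n := fix0_perm (pcomp (path_perm p) psi).

Definition theta_S1 : {set 'S_n} :=
  [set theta_sigma theta_p1; theta_sigma theta_p2; theta_sigma theta_p3].
Definition theta_S2 : {set 'S_n} :=
  [set theta_tau theta_p1; theta_tau theta_p2; theta_tau theta_p3].

Fact theta_path_sorted (s : seq nat) :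
    all (fun i => i <= n) s ->
    sorted (fun i j => theta_arc i j || theta_arc j i) s ->
  sorted theta_edge (map inord s).
Proof.
case: s => //= x s /andP[]; elim: s x => //= y s IHs x le_x /andP[le_y le_s].
by case/andP=> e_xy p_s; rewrite /theta_edge !inordK ?ltnS // e_xy IHs.
Qed.

Lemma theta_p1_path : sorted theta_edge theta_p1.
Proof.
apply: theta_path_sorted.
  by apply/allP=> i; rewrite mem_iota /n; lia.
have H m k : m + k <= 2 * a + 1 ->
    path (fun i j => theta_arc i j || theta_arc j i) m (iota m.+1 k).
  elim: k m => //= k IHk m le_mk.
  by rewrite IHk ?andbT /theta_arc; lia.
by rewrite addn2; apply: (H 0 a.+1); lia.
Qed.

Lemma theta_p2_path : sorted theta_edge theta_p2.
Proof.
apply: theta_path_sorted.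
  by apply/allP=> i; rewrite inE mem_rcons inE mem_iota /n; lia.
have H m k : 2 * a + 2 <= m -> m + k = 2 * a + b + 1 -> b != 0 ->
    path (fun i j => theta_arc i j || theta_arc j i) m
         (rcons (iota m.+1 k) (a + 1)).
  elim: k m => /= [|k IHk] m le_m e_mk b0.
    by rewrite /theta_arc (negPf b0); lia.
  by rewrite IHk ?andbT /theta_arc; lia.
have [b0 | b_gt0] := posnP b.
  by rewrite b0 /= /theta_arc b0 /= eqxx !orbT.
have eb := prednK b_gt0.
rewrite -[in iota _ b]eb /= H; try lia.
by rewrite andbT /theta_arc (gtn_eqF b_gt0) !eqxx !orbT.
Qed.

Lemma theta_p3_path : sorted theta_edge theta_p3.
Proof.
apply: theta_path_sorted.
  by apply/allP=> i; rewrite inE mem_rev mem_iota /n; lia.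
have rev_iotaS k : rev (iota (a + 1) (k + 1)) =
    (a + 1 + k) :: rev (iota (a + 1) k) by rewrite iotaD rev_cat.
have H k : k <= a ->
    path (fun i j => theta_arc i j || theta_arc j i) (a + 1 + k)
         (rev (iota (a + 1) k)).
  elim: k => // k IHk le_k.
  by rewrite -[k.+1]addn1 rev_iotaS /= IHk ?andbT /theta_arc; lia.
by rewrite rev_iotaS /= H // andbT /theta_arc; lia.
Qed.

Fact inord_ord0 : inord 0 = ord0 :> V.
Proof. by apply: val_inj; rewrite /= inordK. Qed.

Fact rho0 : rho ord0 = inord (a + 1).
Proof. by rewrite permE /rho_fun /rho_nat /= modn_small //; lia. Qed.

Fact psi0 : psi ord0 = inord (a + 1).
Proof. by rewrite permE /psi_fun /psi_nat /= subn0. Qed.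

Definition theta_paths := [:: theta_p1; theta_p2; theta_p3].

Lemma theta_path_perm p : p \in theta_paths ->
  path_perm p (inord (a + 1)) = ord0.
Proof.
have H q : last ord0 q = inord (a + 1) ->
    path_perm (ord0 :: q) (inord (a + 1)) = ord0.
  by move=> <-; apply: path_perm_last.
rewrite !inE => /or3P[] /eqP->.
- have -> : theta_p1 = ord0 :: map inord (iota 1 a.+1).
    by rewrite /theta_p1 addn2 -inord_ord0.
  apply: H.
  by rewrite -inord_ord0 last_map -[a.+1]addn1 iotaD last_cat /= add1n addn1.
- rewrite /theta_p2 map_cons inord_ord0; apply: H.
  by rewrite -inord_ord0 last_map last_rcons.
- rewrite /theta_p3 map_cons inord_ord0; apply: H.
  by rewrite -inord_ord0 last_map addn1 /= rev_cons last_rcons.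
Qed.

Lemma theta_sigmaP p j : p \in theta_paths ->
  path_perm p (rho (lift ord0 j)) = lift ord0 (theta_sigma p j).
Proof.
move=> p_in; rewrite -fix0_permP ?pcompE //.
by rewrite rho0 theta_path_perm.
Qed.

Lemma theta_tauP p j : p \in theta_paths ->
  path_perm p (psi (lift ord0 j)) = lift ord0 (theta_tau p j).
Proof.
move=> p_in; rewrite -fix0_permP ?pcompE //.
by rewrite psi0 theta_path_perm.
Qed.

End Theta.

(* Main.v *)
From HB Require Import structures.
Require Import Defs.
From mathcomp Require Import all_boot all_fingroup all_solvable.
From mathcomp Require Import zify.

(** The idea is to read both digraphs as graphs of moves in a sliding puzzle.

    Sliding the hole along the [k]-th path of the theta graph, from one hub to
    the other, permutes the vertices by a cycle [slide_perm k], where [k] is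
    one of three colours: [Lft] and [Rgt] for the two outer paths, [Mid] for the
    middle one.  Both [rho] and [psi] reverse the paths, [rho] exchanging the
    outer two and [psi] keeping each.  Hence the generators [sigma k] satisfy
    [sigma (bar k) = (sigma k)^-1], with [bar] exchanging [Lft] and [Rgt],
    whereas the generators [tau k] are involutions; and in both families a
    product of an even number of generators is, restricted to the indices other
    than 0, an alternating product of slides and inverse slides ([sigmaM],
    [tauM]).  So the two graphs have the same closed walks of even length,
    described by the same words in the colours, the relators.  They differ only
    in how an edge is named from its far end: [rho] makes it change its colour
    by [bar], [psi] does not.

    Let [f] be an isomorphism.  At a vertex [g] it induces a bijection
    [image_color g] between the colours of the edges at [g] and at [f g], and
    along any path it maps relators to relators.  Call [f] rigid if, whenever
    two edges at the ends of a third one have the same colour, so have their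
    images; then [image_color] is composed with [bar] each time an edge is
    crossed.  For a rigid [f] the elements whose multiplication leaves
    [image_color] unchanged form a subgroup that contains all products of two
    generators but not [sigma Lft] ([rigid_proper]).  But the products of two
    generators form a puzzle group, and unless [(a, b) = (2, 1)] such a group
    contains every even permutation of the tiles, and every permutation if
    [a + b] is odd ([puzzle_even], [puzzle_all]: a case of a theorem of Wilson),
    hence also [sigma Lft]: contradiction.

    Rigidity comes from short relators.  Going round all three paths twice
    permutes very few tiles: a product of two transpositions, or a 3-cycle if
    [b = 0] ([double_tour], [double_tour_empty]).  So (ijk)^4, respectively
    (ijk)^6, is a relator for any three distinct colours.  If no cyclically
    reduced relator of the same length, 12 or 18, begins with two equal colours
    around a third one, then [f] is rigid, since the colour of the third edge of
    a path can be recognised from the closed walks through it.  That there is no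
    such relator is a finite check for each [(a, b)], and a single check is valid
    for all large sizes, because a short word moves a tile only a few steps.

    If one of the sizes is small, further relators may appear.  Then closed
    walks are used to recognise the edges of colour [Mid] only (the last three
    patterns of [detectable]).  This is enough, because a word of length
    2(a + b + 1) in which every second colour is [Mid] can be a relator only if
    its other colours are all equal ([ladder_rigid]): every tile that moves at
    all must go all the way round a circle, and this takes all the available
    moves.  In the remaining case [(a, b) = (1, 0)] one of the generators
    [tau k] is 1, so that only one of the two graphs has loops. *)

Set Implicit Arguments.
Unset Strict Implicit.
Unset Printing Implicit Defensive.

Import GroupScope.

(** * Products of transpositions *)

Section PathPerm.

Variable T : finType.
Implicit Types (p : seq T) (x v : T).

Local Arguments path_perm : simpl never.

Let path_perm2 x y p :
  path_perm [:: x, y & p] = path_perm (y :: p) * tperm x y.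
Proof. by []. Qed.

Let path_perm1 x : path_perm [:: x] = 1. Proof. by []. Qed.

Lemma path_perm_out p v : v \notin p -> path_perm p v = v.
Proof.
elim: p => [|x [|y p] IHp]; rewrite ?perm1 //.
rewrite inE negb_or => /andP[ne_x p'v]; rewrite path_perm2 permM IHp //.
by move: p'v; rewrite inE negb_or => /andP[ne_y _]; rewrite tpermD // eq_sym.
Qed.

Lemma path_perm_nth x0 p i :
  uniq p -> i.+1 < size p -> path_perm p (nth x0 p i) = nth x0 p i.+1.
Proof.
elim: p i => [|x [|y p] IHp] // i /andP[p'x uniq_p] lt_ip.
rewrite path_perm2 permM; case: i lt_ip => [|i] lt_ip.
  by rewrite [nth _ _ 0]/= path_perm_out // tpermL.
rewrite [nth _ _ i.+1]/= IHp //= tpermD //.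
  by apply: contraNneq p'x => ->; rewrite inE mem_nth ?orbT.
by case/andP: uniq_p => p'y _; apply: contraNneq p'y => ->; rewrite mem_nth.
Qed.

Lemma odd_path_perm p : uniq p -> odd_perm (path_perm p) = odd (size p).-1.
Proof.
elim: p => [|x [|y p] IHp]; rewrite ?odd_perm1 //.
rewrite cons_uniq => /andP[p'x /IHp].
rewrite path_perm2 odd_permM odd_tperm => -> /=.
by rewrite (contraNneq _ p'x) ?addbT // => ->; rewrite mem_head.
Qed.

Lemma path_perm_rcons p x y :
  path_perm (rcons (rcons p x) y) = tperm x y * path_perm (rcons p x).
Proof.
elim: p => [|z [|u p] IHp]; rewrite ?rcons_cons ?path_perm2 ?path_perm1 ?mul1g ?mulg1 //.
by rewrite -!rcons_cons IHp mulgA.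
Qed.

Lemma path_perm_rev p : path_perm (rev p) = (path_perm p)^-1.
Proof.
elim: p => [|x [|y p] IHp]; rewrite ?invg1 //.
by rewrite path_perm2 invMg tpermV -IHp !rev_cons path_perm_rcons tpermC.
Qed.

Lemma path_perm_map (s : {perm T}) p : path_perm (map s p) = path_perm p ^ s.
Proof.
elim: p => [|x [|y p] IHp]; rewrite ?conj1g //.
by rewrite path_perm2 conjMg tpermJ -IHp.
Qed.

End PathPerm.

(** * Groups that contain a 3-cycle *)

Section Jordan.

Variable T : finType.
Implicit Types (x y z : T) (s h : {perm T}).

Definition cycle3 x y z : {perm T} := tperm x y * tperm x z.

Lemma cycle3_1 x y z : x != y -> y != z -> cycle3 x y z x = y.
Proof. by move=> ne_xy ne_yz; rewrite /cycle3 permM tpermL tpermD // eq_sym. Qed.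

Lemma cycle3_2 x y z : cycle3 x y z y = z.
Proof. by rewrite /cycle3 permM tpermR tpermL. Qed.

Lemma cycle3_3 x y z : x != z -> y != z -> cycle3 x y z z = x.
Proof. by move=> ne_xz ne_yz; rewrite /cycle3 permM [tperm x y z]tpermD // tpermR. Qed.

Lemma cycle3_out x y z v : x != v -> y != v -> z != v -> cycle3 x y z v = v.
Proof. by move=> ne_x ne_y ne_z; rewrite /cycle3 permM !tpermD. Qed.

Lemma cycle3J x y z h : cycle3 x y z ^ h = cycle3 (h x) (h y) (h z).
Proof. by rewrite conjMg !tpermJ. Qed.

Lemma cycle3V x y z : (cycle3 x y z)^-1 = cycle3 x z y.
Proof. by rewrite invMg !tpermV. Qed.

Lemma cycle3_rot x y z : x != y -> y != z -> x != z -> cycle3 x y z = cycle3 y z x.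
Proof.
move=> ne_xy ne_yz ne_xz.
by rewrite /cycle3 [in LHS]conjgCV tpermV tpermJ tpermL tpermD // [tperm y x]tpermC.
Qed.

Variables (H : {group {perm T}}) (S : {set T}).

(** The set [S] bounds the third point too, so that this relation can be handled
    inside [S]. *)
Definition linked x y :=
  (x == y) || [exists z in S, [&& z != x, z != y & cycle3 x y z \in H]].

Lemma linkedP x y : x != y ->
  reflect (exists2 z, z \in S & [/\ z != x, z != y & cycle3 x y z \in H]) (linked x y).
Proof.
move=> ne_xy; rewrite /linked (negPf ne_xy).
by apply: (iffP exists_inP) => -[z Sz /and3P]; exists z.
Qed.

Lemma linked_refl x : linked x x. Proof. by rewrite /linked eqxx. Qed.

Lemma linked_sym x y : linked x y -> linked y x.
Proof.
have [-> // | ne_xy] := eqVneq x y; have ne_yx : y != x by rewrite eq_sym.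
case/(linkedP ne_xy)=> z Sz [ne_zx ne_zy]; rewrite -groupV cycle3V => H_c.
apply/linkedP=> //; exists z; rewrite // ne_zx ne_zy; split=> //.
by rewrite cycle3_rot // eq_sym.
Qed.

Hypothesis stabHS : {in H & S, forall h x, h x \in S}.

Lemma linkedJ h x y : h \in H -> linked x y -> linked (h x) (h y).
Proof.
move=> Hh; have [-> _ | ne_xy] := eqVneq x y; first exact: linked_refl.
case/(linkedP ne_xy)=> z Sz [ne_zx ne_zy H_c]; apply/linkedP; rewrite ?(inj_eq perm_inj) //.
by exists (h z); rewrite ?stabHS // !(inj_eq perm_inj) -cycle3J groupJ.
Qed.

(** Some power of a 3-cycle through [x] and [y] sends [y] to [x], and it fixes [z]
    unless [z] is already on that cycle. *)
Lemma linked_trans x y z : x \in S -> y \in S ->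
  linked x y -> linked y z -> linked x z.
Proof.
move=> Sx Sy; have [-> // | ne_xy] := eqVneq x y.
have [-> _ _ | ne_xz] := eqVneq x z; first exact: linked_refl.
have [-> // | ne_yz] := eqVneq y z.
case/(linkedP ne_xy)=> w Sw [ne_wx ne_wy H_c] link_yz.
have [eq_wz | ne_wz] := eqVneq w z.
  apply/linkedP=> //; exists y => //; split; rewrite // 1?eq_sym //.
  by rewrite -groupV cycle3V -eq_wz.
have := linkedJ (groupVr H_c) link_yz; rewrite cycle3V.
by rewrite cycle3_3 ?cycle3_out // eq_sym.
Qed.

Hypothesis primitiveHS : forall R : rel T,
    reflexive R -> symmetric R -> {in S & &, forall x y z, R x y -> R y z -> R x z} ->
    (forall h x y, h \in H -> R x y -> R (h x) (h y)) ->
    (exists x y, [/\ x \in S, y \in S, x != y & R x y]) ->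
  {in S &, forall x y, R x y}.

(** Jordan's theorem on primitive groups, for a group [H] acting on a set [S] of
    points that it may not exhaust; [primitiveHS] expresses primitivity by
    invariant equivalence relations.  Sharing a 3-cycle of [H] is such a relation,
    hence any two points share one; conjugating by further 3-cycles then gives
    them all, and composing an even permutation with a suitable 3-cycle makes
    it fix one more point. *)
Theorem even_perm_in_primitive x0 y0 z0 :
    x0 \in S -> y0 \in S -> z0 \in S -> x0 != y0 -> y0 != z0 -> x0 != z0 ->
    cycle3 x0 y0 z0 \in H ->
  forall s, perm_on S s -> ~~ odd_perm s -> s \in H.
Proof.
move=> Sx0 Sy0 Sz0 ne_xy0 ne_yz0 ne_xz0 H_c0.
have linkS : {in S &, forall x y, linked x y}.
  apply: primitiveHS => [x|x y|x y z Sx Sy _|h x y|].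
  - exact: linked_refl.
  - by apply/idP/idP; apply: linked_sym.
  - exact: linked_trans.
  - exact: linkedJ.
  exists x0, y0; split=> //; apply/linkedP=> //; exists z0 => //.
  by split; rewrite // eq_sym.
have cycle3H x y z : x \in S -> y \in S -> z \in S ->
    x != y -> y != z -> x != z -> cycle3 x y z \in H.
  move=> Sx Sy Sz ne_xy ne_yz ne_xz.
  have [ne_yx ne_zy ne_zx] : [/\ y != x, z != y & z != x].
    by rewrite ![_ == x]eq_sym [z == y]eq_sym.
  have /(linkedP ne_xy)[w Sw [ne_wx ne_wy H_w]] := linkS x y Sx Sy.
  have [<- // | ne_wz] := eqVneq w z.
  have /(linkedP ne_wz)[u Su [ne_uw ne_uz H_u]] := linkS w z Sw Sz.
  have [eq_ux | ne_ux] := eqVneq u x.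
    have := groupJ H_w (groupVr H_u); rewrite eq_ux cycle3V cycle3J.
    by rewrite cycle3_2 cycle3_out // cycle3_1 // -groupV cycle3V cycle3_rot.
  have [eq_uy | ne_uy] := eqVneq u y.
    have := groupJ H_w (groupVr H_u); rewrite eq_uy cycle3V cycle3J.
    rewrite cycle3_out // cycle3_2 cycle3_1 // -groupV cycle3V //.
  have := groupJ H_w H_u; rewrite cycle3J.
  by rewrite !(cycle3_out _ (v := x), cycle3_out _ (v := y)) // cycle3_1 // eq_sym.
move=> s; have [m] := ubnP #|[set x | s x != x]|.
elim: m s => // m IHm s le_s suppS even_s.
case: (pickP (fun x => s x != x)) => [x ne_sx | s_id]; last first.
  have -> : s = 1 by apply/permP=> x; rewrite perm1; apply/eqP/negPn; rewrite s_id.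
  exact: group1.
have S_moved v : s v != v -> v \in S by apply: contraNT => /(out_perm suppS)->.
have ne_ssx : s (s x) != s x by rewrite (inj_eq perm_inj).
case: (pickP (fun w => [&& s w != w, w != x & w != s x])) => [w /and3P[ne_sw ne_wx ne_wsx] | only2].
  have ne_xw : x != w by rewrite eq_sym.
  have ne_sxw : s x != w by rewrite eq_sym.
  (* Chosen so that [s * c] fixes [x] and moves no new point. *)
  pose c := cycle3 (s x) x w.
  have Hc : c \in H by apply: cycle3H; rewrite ?S_moved.
  have c_out v : v != s x -> v != x -> v != w -> c v = v.
    by move=> *; rewrite cycle3_out // eq_sym.
  have fix_sc v : s v = v -> (s * c) v = v.
    move=> sv; have moved u : s u != u -> v != u.
      by move=> ne_u; apply: contraNneq ne_u => <-; rewrite sv.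
    by rewrite permM sv c_out ?moved.
  rewrite -(groupMr _ Hc); apply: IHm.
  - rewrite ltnS in le_s; apply: leq_trans le_s; apply/proper_card/properP; split.
      by apply/subsetP=> v; rewrite !inE; apply: contra => /eqP/fix_sc->.
    by exists x; rewrite !inE ?ne_sx // permM /c cycle3_1 ?eqxx.
  - apply/subsetP=> v; rewrite inE => ne_v; apply: S_moved.
    by apply: contra ne_v => /eqP/fix_sc->.
  by rewrite odd_permM (negPf even_s) odd_permM !odd_tperm ne_sx ne_sxw.
(* Otherwise [s] moves only [x] and [s x], so it is a transposition. *)
case/negP: even_s; suff ->: s = tperm x (s x) by rewrite odd_tperm eq_sym.
apply/permP=> v; have [-> | ne_vx] := eqVneq v x; first by rewrite tpermL.
have [-> | ne_vsx] := eqVneq v (s x).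
  rewrite tpermR; apply/eqP/negPn/negP=> ne_ssx_x.
  by have := only2 (s (s x)); rewrite (inj_eq perm_inj) ne_ssx ne_ssx_x.
rewrite tpermD 1?eq_sym //; apply/eqP/negPn/negP=> ne_sv.
by have := only2 v; rewrite ne_sv ne_vx ne_vsx.
Qed.

End Jordan.

Local Open Scope nat_scope.

(** * Elementary facts about permutations *)

Section Fix0.

Variable n : nat.
Implicit Types g h : {perm 'I_n.+1}.

(** Expressing [fix0_perm] through [lift_perm] gives access to the known parity of
    [lift_perm]. *)
Lemma lift_fix0 h : h ord0 = ord0 -> lift_perm ord0 ord0 (fix0_perm h) = h.
Proof.
move=> h0; apply/permP=> i; case: (unliftP ord0 i) => [j|] ->.
  by rewrite lift_perm_lift fix0_permP.
by rewrite lift_perm_id h0.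
Qed.

Lemma odd_fix0 h : h ord0 = ord0 -> odd_perm (fix0_perm h) = odd_perm h.
Proof. by move=> h0; rewrite -{2}(lift_fix0 h0) odd_lift_perm. Qed.

Lemma fix0M g h : g ord0 = ord0 -> h ord0 = ord0 ->
  fix0_perm (g * h)%g = (fix0_perm g * fix0_perm h)%g.
Proof.
move=> g0 h0; apply/permP=> j; apply: (@lift_inj _ ord0).
by rewrite -fix0_permP permM ?g0 // permM -!fix0_permP.
Qed.

Lemma fix0_inj g h : g ord0 = ord0 -> h ord0 = ord0 -> fix0_perm g = fix0_perm h -> g = h.
Proof. by move=> g0 h0 eq_gh; rewrite -(lift_fix0 g0) -(lift_fix0 h0) eq_gh. Qed.

End Fix0.

(** All cycles of such a permutation are transpositions, and they cover [T]. *)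
Lemma odd_involution (T : finType) (s : {perm T}) :
  (forall x, s (s x) = x) -> (forall x, s x != x) -> odd_perm s = odd #|T|./2.
Proof.
move=> sK s_free; have card_orbit x : #|porbit s x| = 2.
  have -> : porbit s x = [set x; s x]; last by rewrite cards2 eq_sym s_free.
  apply/setP=> y; rewrite !inE; apply/porbitP/orP=> [[i ->] | [/eqP-> | /eqP->]].
  - elim: i => [|i IHi]; first by left; rewrite expg0 perm1.
    by rewrite expgSr permM; case: IHi => /eqP->; rewrite ?sK eqxx; [right | left].
  - by exists 0; rewrite expg0 perm1.
  by exists 1; rewrite expg1.
suff card_T : #|T| = #|porbits s| * 2.
  by rewrite /odd_perm card_T muln2 doubleK odd_double.
rewrite -cardsT; apply: card_uniform_partition => [A /imsetP[x _ ->] //|].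
apply/and3P; split.
- apply/eqP/setP=> x; rewrite inE; apply/bigcupP.
  by exists (porbit s x); rewrite ?imset_f ?porbit_id.
- apply/trivIsetP=> _ _ /imsetP[x _ ->] /imsetP[y _ ->]; apply: contraNT.
  case/pred0Pn=> z /andP[/= xz yz].
  have /eqP <- : porbit s z == porbit s x by rewrite eq_porbit_mem.
  by rewrite eq_porbit_mem.
by apply/imsetP=> -[x _ /esym/eqP]; rewrite -cards_eq0 card_orbit.
Qed.

Lemma tperm_commute (T : finType) (x y z w : T) :
  x != z -> x != w -> y != z -> y != w -> commute (tperm x y) (tperm z w).
Proof.
move=> ne_xz ne_xw ne_yz ne_yw.
by rewrite /commute (conjgC (tperm x y)) tpermJ !tpermD // eq_sym.
Qed.

Lemma tperm2_sq (T : finType) (x y z w : T) :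
  x != z -> x != w -> y != z -> y != w ->
  (tperm x y * tperm z w * (tperm x y * tperm z w) = 1)%g.
Proof.
move=> ne_xz ne_xw ne_yz ne_yw; rewrite {2}(tperm_commute ne_xz) //.
by rewrite mulgA -(mulgA (tperm x y)) tperm2 mulg1 tperm2.
Qed.

Lemma tperm3_cube (T : finType) (x y z : T) : x != y -> x != z -> y != z ->
  (tperm x y * tperm x z * (tperm x y * tperm x z) * (tperm x y * tperm x z) = 1)%g.
Proof.
move=> ne_xy ne_xz ne_yz; apply/permP=> v; rewrite !permM perm1.
have [ne_yx ne_zx ne_zy] : [/\ y != x, z != x & z != y] by rewrite ![_ == x]eq_sym [z == y]eq_sym.
have [-> | ne_vx] := eqVneq v x.
  by rewrite tpermL [tperm x z y]tpermD // tpermR tpermL [tperm x y z]tpermD // tpermR.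
have [-> | ne_vy] := eqVneq v y.
  by rewrite tpermR tpermL [tperm x y z]tpermD // tpermR tpermL tpermD.
have [-> | ne_vz] := eqVneq v z.
  by rewrite [tperm x y z]tpermD // tpermR tpermL [tperm x z y]tpermD // tpermR tpermL.
by rewrite !(tpermD _ _ (z := v)) 1?eq_sym // eq_sym.
Qed.

(** * Words in three colours *)

Inductive color := Lft | Mid | Rgt.

Definition color_eqb (i j : color) : bool :=
  match i, j with Lft, Lft | Mid, Mid | Rgt, Rgt => true | _, _ => false end.

Fact color_eqP : Equality.axiom color_eqb.
Proof. by case; case; constructor. Qed.

HB.instance Definition _ := hasDecEq.Build color color_eqP.

Definition bar k := match k with Lft => Rgt | Mid => Mid | Rgt => Lft end.

Lemma barK : involutive bar. Proof. by case. Qed.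

Definition palette := [:: Lft; Mid; Rgt].

(** The words without backtracking: consecutive edges of a walk have different
    colours as seen from their common vertex. *)
Definition reduced : seq color -> bool := sorted (fun i j => i != j).

Fixpoint reduced_words h : seq (seq color) :=
  if h is h'.+1 then
    [seq k :: w | w <- reduced_words h', k <- [seq k <- palette | ohead w != Some k]]
  else [:: [::]].

Lemma mem_reduced_words w : reduced w -> w \in reduced_words (size w).
Proof.
elim: w => //= k w IHw red_w.
apply/allpairsPdep; exists w, k; split=> //.
  by apply: IHw; case: w red_w => //= j w /andP[].
suff: k \in filter (fun k => ohead w != Some k) palette by [].
rewrite mem_filter; apply/andP; split; last by case: k {red_w}.
by case: w red_w {IHw} => //= j w /andP[ne_kj _]; apply: contra ne_kj => /eqP[->].
Qed.

(** * Vertices of the theta graph and the sliding permutations *)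

Section ThetaPerm.

Variables a b : nat.

Local Notation n := (theta_n a b).
Local Notation V := 'I_n.+1.

Definition inner_size k := if k is Mid then b else a.
Local Notation q := inner_size.

(** Each path is numbered from 0, at the first hub, to [(q k).+1], at the second
    one, so the hubs have three names each. *)
Definition vertex_index k i :=
  match k with
  | Lft => i
  | Mid => if i == 0 then 0 else if i == b.+1 then a.+1 else 2 * a + 1 + i
  | Rgt => if i == 0 then 0 else 2 * a + 2 - i
  end.

Definition vertex k i : V := inord (vertex_index k i).

Definition tpath k : seq V :=
  match k with Lft => theta_p1 a b | Mid => theta_p2 a b | Rgt => theta_p3 a b end.

Definition slide_perm k := path_perm (tpath k).

Local Notation vtx := vertex.
Local Notation slide := slide_perm.
Local Notation hub0 := (vertex Lft 0).
Local Notation hub1 := (vertex Lft a.+1).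

Lemma vtxE k i : i <= (q k).+1 -> vtx k i = vertex_index k i :> nat.
Proof.
move=> le_i; rewrite inordK // ltnS /theta_n.
by case: k le_i => /= le_i; repeat case: ifP; lia.
Qed.

Lemma vtx0 k : vtx k 0 = hub0. Proof. by case: k. Qed.

Lemma vtx_end k : vtx k (q k).+1 = hub1.
Proof. by case: k => //=; rewrite /vertex /= ?eqxx //; congr inord; lia. Qed.

Lemma tpathE k : tpath k = [seq vtx k i | i <- iota 0 (q k).+2].
Proof.
case: k.
- by rewrite /= /theta_p1 addn2.
- have -> : iota 0 (q Mid).+2 = 0 :: iota 1 b ++ [:: b.+1].
    have iotaSr k : iota 1 k.+1 = iota 1 k ++ [:: k.+1] by rewrite -[k.+1]addn1 iotaD addnC.
    by have := congr1 (cons 0) (iotaSr b).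
  rewrite /= /theta_p2 /= -cats1 !map_cat /= [vertex Mid 0]/vertex /=.
  congr (_ :: _ ++ [:: _]); last first.
    by rewrite /vertex /= eqxx addn1.
  have -> : 2 * a + 2 = (2 * a + 1) + 1 by lia.
  rewrite iotaDl -map_comp; apply/eq_in_map=> i; rewrite mem_iota => le_i /=.
  by rewrite /vertex /=; congr inord; repeat case: ifP; lia.
- suff eq_p : map inord (rev (iota (a + 1) (a + 1))) = map (vtx Rgt) (iota 1 a.+1).
    by rewrite /= /theta_p3 map_cons eq_p.
  apply: (@eq_from_nth _ ord0) => [|i].
    by rewrite !size_map size_rev !size_iota; lia.
  rewrite size_map size_rev size_iota => lt_i.
  rewrite (nth_map 0) ?size_rev ?size_iota // nth_rev ?size_iota //.
  rewrite nth_iota; last by lia.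
  rewrite (nth_map 0) ?size_iota; last by lia.
  by rewrite nth_iota /vertex /=; [congr inord | ]; lia.
Qed.

Lemma vtx_eqE k l i j : i <= (q k).+1 -> j <= (q l).+1 ->
  (vtx k i == vtx l j) = (vertex_index k i == vertex_index l j).
Proof. by move=> le_i le_j; rewrite -val_eqE /= !vtxE. Qed.

Lemma vtx_inj k i j : i <= (q k).+1 -> j <= (q k).+1 ->
  vtx k i = vtx k j -> i = j.
Proof.
move=> le_i le_j /eqP; rewrite vtx_eqE // => /eqP.
by case: k le_i le_j => //=; repeat case: ifP; lia.
Qed.

Lemma inner_inj k l i j : 0 < i <= q k -> 0 < j <= (q l).+1 ->
  vtx k i = vtx l j -> k = l /\ i = j.
Proof.
move=> le_i le_j /eqP; rewrite vtx_eqE; try lia; move/eqP.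
case: k le_i; case: l le_j => /= le_j le_i; repeat case: ifP => ?.
all: by move=> ?; first [split=> //; lia | exfalso; lia].
Qed.

Lemma uniq_tpath k : uniq (tpath k).
Proof.
rewrite tpathE map_inj_in_uniq ?iota_uniq // => i j.
by rewrite !mem_iota => le_i le_j; apply: vtx_inj; lia.
Qed.

Lemma size_tpath k : size (tpath k) = (q k).+2.
Proof. by rewrite tpathE size_map size_iota. Qed.

Lemma nth_tpath k i : i <= (q k).+1 -> nth hub0 (tpath k) i = vtx k i.
Proof.
by move=> le_i; rewrite tpathE (nth_map 0) ?size_iota ?nth_iota.
Qed.

Lemma slide_vtx k i : i <= q k -> slide k (vtx k i) = vtx k i.+1.
Proof.
move=> le_i; rewrite -(nth_tpath (leqW le_i)) -(@nth_tpath k i.+1) //.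
by rewrite path_perm_nth ?uniq_tpath ?size_tpath.
Qed.

Lemma slide_hub1 k : slide k hub1 = hub0.
Proof.
rewrite -(vtx_end k) -(nth_tpath (leqnn _)) -[(q k).+1]/(_.+2.-1) -size_tpath.
have := tpathE k; rewrite /slide; case: (tpath k) => //= x p [-> _].
by rewrite nth_last -(vtx0 k) /=; apply: path_perm_last.
Qed.

Lemma slide_hub0 k : slide k hub0 = vtx k 1.
Proof. by rewrite -(vtx0 k) slide_vtx. Qed.

Lemma slide_other j k i : j != k -> 0 < i <= q k -> slide j (vtx k i) = vtx k i.
Proof.
move=> ne_jk le_i; apply: path_perm_out; rewrite tpathE.
apply/mapP=> -[m]; rewrite mem_iota => le_m /esym eq_v.
have [m0 | m_gt0] := posnP m.
  rewrite m0 vtx0 -(vtx0 k) in eq_v; have := vtx_inj _ _ eq_v; lia.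
have [|eq_kj _] := inner_inj le_i _ (esym eq_v); first by lia.
by rewrite eq_kj eqxx in ne_jk.
Qed.

Lemma slideV_vtx k i : i <= q k -> (slide k)^-1 (vtx k i.+1) = vtx k i.
Proof. by move=> le_i; rewrite -(slide_vtx le_i) permK. Qed.

Lemma slideV_hub0 k : (slide k)^-1 hub0 = hub1.
Proof. by rewrite -(slide_hub1 k) permK. Qed.

Lemma slideV_hub1 k : (slide k)^-1 hub1 = vtx k (q k).
Proof. by rewrite -(vtx_end k) slideV_vtx. Qed.

Lemma slideV_other j k i : j != k -> 0 < i <= q k -> (slide j)^-1 (vtx k i) = vtx k i.
Proof. by move=> ne_jk le_i; rewrite -{1}(slide_other ne_jk le_i) permK. Qed.

Lemma hub_neq : hub0 != hub1.
Proof. by rewrite vtx_eqE //=; lia. Qed.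

Lemma inner_neq_hub0 k i : 0 < i <= q k -> vtx k i != hub0.
Proof.
by move=> le_i; rewrite -(vtx0 k); apply/eqP=> /vtx_inj; lia.
Qed.

Lemma inner_neq_hub1 k i : 0 < i <= q k -> vtx k i != hub1.
Proof.
by move=> le_i; rewrite -(vtx_end k); apply/eqP=> /vtx_inj; lia.
Qed.

Lemma inner_neq k l i j : 0 < i <= q k -> 0 < j <= q l ->
  (k != l) || (i != j) -> vtx k i != vtx l j.
Proof.
move=> le_i le_j; apply: contraTneq => eq_v.
by have [|-> ->] := inner_inj le_i _ eq_v; [lia | rewrite !eqxx].
Qed.

(** One name for each vertex, although a hub has a name on every path. *)
Variant vtx_spec : V -> Prop :=
  | VtxHub0 : vtx_spec hub0
  | VtxHub1 : vtx_spec hub1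
  | VtxInner k i of 0 < i <= q k : vtx_spec (vtx k i).

Lemma vtxP v : vtx_spec v.
Proof.
have vtx_of k i : i <= (q k).+1 -> val v = vertex_index k i -> vtx_spec v.
  move=> le_i eq_v.
  have ->: v = vtx k i by apply: val_inj; rewrite /= eq_v vtxE.
  have [-> | i_gt0] := posnP i; first by rewrite vtx0; exact: VtxHub0.
  have [lt_i | ge_i] := ltnP i (q k).+1; first by apply: VtxInner; lia.
  have eq_i : i = (q k).+1 by lia.
  by rewrite eq_i vtx_end; exact: VtxHub1.
have [le_v | gt_v] := leqP v a.+1; first exact: (@vtx_of Lft v).
have [le_v | gt_v'] := leqP v (2 * a + 1).
  by apply: (@vtx_of Rgt (2 * a + 2 - v)) => /=; repeat case: ifP; lia.
have lt_v : v < (2 * a + b + 1).+1 := ltn_ord v.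
by apply: (@vtx_of Mid (v - (2 * a + 1))) => /=; repeat case: ifP; lia.
Qed.

End ThetaPerm.

(** Solves [u != v] for hubs and inner vertices of the theta graph. *)
Ltac vneq :=
  solve [ exact: hub_neq | rewrite eq_sym; exact: hub_neq
        | apply: inner_neq_hub0; rewrite /=; lia | apply: inner_neq_hub1; rewrite /=; lia
        | rewrite eq_sym; apply: inner_neq_hub0; rewrite /=; lia
        | rewrite eq_sym; apply: inner_neq_hub1; rewrite /=; lia
        | apply: inner_neq; rewrite /=;
          [lia | lia | first [done | lia | apply/orP; (by left) || (right; lia)]]].

(** * Exhaustive search for short relators *)

(** A model of the theta graph whose paths have [Q k] inner vertices, made for
    evaluation.  If [D k] is positive it is a guard: nothing may move between the
    inner vertices [D k] and [(D k).+1].  A run that respects the guard remains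
    valid when any number of vertices are inserted at the guarded place.
    [D k = 0] means no guard, and then only the size [Q k] itself is modelled. *)
Inductive code := Hub0 | Hub1 | Inner of color & nat.

Definition code_eqb (x y : code) : bool :=
  match x, y with
  | Hub0, Hub0 | Hub1, Hub1 => true
  | Inner j m, Inner k n => (m == n) && (j == k)
  | _, _ => false
  end.

Fact code_eqP : Equality.axiom code_eqb.
Proof.
case=> [||j m]; case=> [||k n] /=; try by constructor.
by apply: (iffP andP) => [[/eqP-> /eqP->] | [-> ->]].
Qed.

HB.instance Definition _ := hasDecEq.Build code code_eqP.

Definition prefix3 (B : color -> color -> color -> bool) (w : seq color) :=
  if w is [:: i, j, k & _] then B i j k else false.

(** Patterns for the first three letters of a word; the last one looks at two. *)
Definition returns (i j k : color) := i == k.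
Definition zigzags (i j k : color) := [&& i == k, i != Mid, j != Mid & i != j].
Definition avoids_mid (i j k : color) := (i != Mid) && (j != Mid).

Section Model.

Variables (Q D : color -> nat).

Definition push k (x : code) : option code :=
  match x with
  | Hub0 => Some (if Q k is 0 then Hub1 else Inner k 1)
  | Hub1 => Some Hub0
  | Inner j i =>
    if j != k then Some x
    else if i == D k then None
    else Some (if i == Q k then Hub1 else Inner k i.+1)
  end.

Definition pull k (x : code) : option code :=
  match x with
  | Hub0 => Some Hub1
  | Hub1 => Some (if Q k is 0 then Hub0 else Inner k (Q k))
  | Inner j i =>
    if j != k then Some x
    else if i is 1 then Some Hub0
    else if i.-1 == D k then None
    else Some (Inner k i.-1)
  end.

(** The boolean tells whether the next slide is direct or inverse; the two
    alternate because the hole goes back and forth between the hubs. *)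
Fixpoint track (l : bool) (w : seq color) (x : code) : option code :=
  if w is k :: w' then
    if (if l then push k x else pull k x) is Some y then track (~~ l) w' y
    else None
  else Some x.

Definition codes : seq code :=
  [:: Hub0, Hub1 & [seq Inner k i | k <- palette, i <- iota 1 (Q k)]].

Definition clash (x y : option code) : bool :=
  if x is Some x' then if y is Some y' then x' != y' else false else false.

(** Meet in the middle: a closed word of length [2h] is a pair of words of length
    [h] that act in the same way, the second one read backwards.  Such a pair is
    excluded if it would not be cyclically reduced, which shows at its two
    junctions, or if some vertex tracked along both words ends at different
    places.  An interrupted track gives no information, so it excludes nothing. *)
Definition no_circuit B h : bool :=
  let T := [seq (w, [seq track false w x | x <- codes]) | w <- reduced_words h] in
  all (fun p => prefix3 B p.1 ==>
    all (fun q => [|| ohead p.1 == ohead q.1, ohead (rev p.1) == ohead (rev q.1)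
                    | has (fun xy => clash xy.1 xy.2) (zip p.2 q.2)]) T) T.

End Model.

Section Sweep.

Variables a b : nat.

Local Notation n := (theta_n a b).
Local Notation V := 'I_n.+1.
Local Notation q := (inner_size a b).
Local Notation vtx := (vertex a b).
Local Notation slide := (slide_perm a b).
Local Notation hub0 := (vtx Lft 0).
Local Notation hub1 := (vtx Lft a.+1).

(** Products in {perm V} act from left to right, so the leftmost letter moves
    first: this is how tiles move, while the product of generators along a walk
    is its inverse. *)
Fixpoint word_perm (l : bool) (w : seq color) : {perm V} :=
  if w is k :: w' then ((if l then slide k else (slide k)^-1) * word_perm (~~ l) w')%g
  else 1%g.

Local Notation sweep := word_perm.

Definition is_relator w := sweep false w == 1%g.

Local Notation relator := is_relator.

Lemma sweep_cat l w1 w2 :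
  sweep l (w1 ++ w2) = (sweep l w1 * sweep (l (+) odd (size w1)) w2)%g.
Proof.
elim: w1 l => [|k w1 IHw] l /=; first by rewrite mul1g addbF.
by rewrite IHw mulgA addbN addNb.
Qed.

Lemma sweep_rev l w : sweep (l (+) odd (size w)) (rev w) = (sweep l w)^-1%g.
Proof.
elim: w l => [|k w IHw] l /=; first by rewrite invg1.
rewrite rev_cons -cats1 sweep_cat size_rev addbN -addNb IHw invMg; congr (_ * _)%g.
by rewrite -addbA addbb addbF /= mulg1; case: l; rewrite ?invgK.
Qed.

Lemma relator_rev w : ~~ odd (size w) -> relator (rev w) = relator w.
Proof.
move=> even_w; rewrite /is_relator -[X in sweep X _](addbF false).
by rewrite -(negPf even_w) sweep_rev eq_invg1.
Qed.

Lemma relator_catC w1 w2 : ~~ odd (size w1) -> ~~ odd (size w2) ->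
  relator (w1 ++ w2) = relator (w2 ++ w1).
Proof.
move=> /negPf even1 /negPf even2; rewrite /is_relator !sweep_cat even1 even2 /=.
by rewrite -!eq_invg_mul eq_invg_sym eq_sym.
Qed.

Lemma relator_halves w1 w2 : odd (size w1) = odd (size w2) ->
  relator (w1 ++ w2) = (sweep false w1 == sweep false (rev w2)).
Proof.
move=> eq_odd; rewrite /is_relator sweep_cat /= eq_odd.
have := sweep_rev false (rev w2); rewrite revK size_rev /= => ->.
by rewrite -eq_mulgV1.
Qed.

Section Tracking.

Variables (Q D : color -> nat).

Definition fits_model :=
  forall k, (D k = 0 /\ Q k = q k) \/ (0 < D k < Q k /\ Q k <= q k).

Hypothesis fitsQD : fits_model.

(** The missing vertices are inserted just behind the guard. *)
Definition vtx_of_code x :=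
  match x with
  | Hub0 => hub0
  | Hub1 => hub1
  | Inner k i => vtx k (if D k < i then i + (q k - Q k) else i)
  end.

Definition valid_code x := if x is Inner k i then 0 < i <= Q k else true.

Lemma codes_valid x : x \in codes Q -> valid_code x.
Proof.
rewrite !inE => /or3P[/eqP-> // | /eqP-> // |].
by case/allpairsPdep=> k [i [_]]; rewrite mem_iota => le_i ->; rewrite /=; lia.
Qed.

Lemma vtx_of_code_inj x y :
  valid_code x -> valid_code y -> vtx_of_code x = vtx_of_code y -> x = y.
Proof.
have inner_code k i : valid_code (Inner k i) ->
    0 < (if D k < i then i + (q k - Q k) else i) <= q k.
  by move=> /= le_i; case: (fitsQD k); case: ifP; lia.
case: x => [||k i] x_ok; case: y => [||l j] y_ok //=.
- by move/eqP; rewrite (negPf (hub_neq _ _)).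
- by move/esym/eqP; rewrite (negPf (inner_neq_hub0 (inner_code _ _ y_ok))).
- by move/esym/eqP; rewrite (negPf (hub_neq _ _)).
- by move/esym/eqP; rewrite (negPf (inner_neq_hub1 (inner_code _ _ y_ok))).
- by move/eqP; rewrite (negPf (inner_neq_hub0 (inner_code _ _ x_ok))).
- by move/eqP; rewrite (negPf (inner_neq_hub1 (inner_code _ _ x_ok))).
have := inner_code _ _ y_ok; have := inner_code _ _ x_ok => le_i le_j eq_v.
have [|eq_kl eq_ij] := inner_inj le_i _ eq_v; first by lia.
rewrite -eq_kl in eq_ij *; congr Inner.
by move: eq_ij; case: (fitsQD k); do 2!case: ifP; lia.
Qed.

Lemma push_sound k x y : valid_code x -> push Q D k x = Some y ->
  valid_code y /\ slide k (vtx_of_code x) = vtx_of_code y.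
Proof.
case: x => [||j i] /= x_ok; last first.
- have [<-{k} | ne_jk] /= := eqVneq j k; last first.
    case=> <-; split=> //=; rewrite slide_other 1?eq_sym //.
    by case: (fitsQD j); case: ifP; lia.
  case: eqP => // ne_iD; case=> <-.
  have [eq_i | ne_i] := eqVneq i (Q j).
    split=> //=; rewrite slide_vtx -?(vtx_end a b j); last by case: (fitsQD j); case: ifP; lia.
    by congr vertex; case: (fitsQD j); case: ifP; lia.
  split=> /=; first by lia.
  rewrite slide_vtx; last by case: (fitsQD j); case: ifP; lia.
  by congr vertex; case: (fitsQD j); do 2!case: ifP; lia.
- by case=> <-; rewrite /= slide_hub1.
case=> <-; have := fitsQD k; case eqQ: (Q k) => [|m] fit_k /=; rewrite slide_hub0.
  by rewrite -(vtx_end a b k); split=> //; congr vertex; lia.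
by rewrite eqQ; split=> //; congr vertex; case: ifP; lia.
Qed.

Lemma pull_sound k x y : valid_code x -> pull Q D k x = Some y ->
  valid_code y /\ (slide k)^-1%g (vtx_of_code x) = vtx_of_code y.
Proof.
case: x => [||j i] /= x_ok; last first.
- have [<-{k} | ne_jk] /= := eqVneq j k; last first.
    case=> <-; split=> //=; rewrite slideV_other 1?eq_sym //.
    by case: (fitsQD j); case: ifP; lia.
  have slideV m : 0 < m <= (q j).+1 -> (slide j)^-1%g (vtx j m) = vtx j m.-1.
    by case: m => // m le_m; rewrite slideV_vtx //; lia.
  case: i x_ok => [|[|i]] // x_ok; last first.
    case: eqP => //= ne_iD; case=> <-; split=> /=; first by lia.
    rewrite slideV; last by case: (fitsQD j); case: ifP; lia.
    by congr vertex; case: (fitsQD j); do 2!case: ifP; lia.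
  case=> <-; split=> //=; rewrite slideV; last by case: (fitsQD j); case: ifP; lia.
  rewrite -(vtx0 a b j); congr vertex.
  by case: (fitsQD j); case: ifP; lia.
- case=> <-; have := fitsQD k; case eqQ: (Q k) => [|m] fit_k /=; rewrite slideV_hub1.
    by rewrite -(vtx0 a b k); split=> //; congr vertex; lia.
  by rewrite eqQ leqnn; split=> //; congr vertex; case: ifP; lia.
by case=> <-; rewrite /= slideV_hub0.
Qed.

Lemma track_sound l w x y : valid_code x -> track Q D l w x = Some y ->
  valid_code y /\ sweep l w (vtx_of_code x) = vtx_of_code y.
Proof.
elim: w l x => [|k w IHw] l x x_ok /=; first by case=> <-; rewrite perm1.
case def_z: (if l then _ else _) => [z|] //.
have [z_ok eq_z] : valid_code z /\
    (if l then slide k else (slide k)^-1%g) (vtx_of_code x) = vtx_of_code z.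
  by case: l def_z; [apply: push_sound | apply: pull_sound].
by move/(IHw _ _ z_ok); rewrite permM eq_z.
Qed.

Lemma clash_sound l w v x : valid_code x ->
  clash (track Q D l w x) (track Q D l v x) -> sweep l w != sweep l v.
Proof.
move=> x_ok; case def_y: (track _ _ _ w x) => [y|] //=.
case def_z: (track _ _ _ v x) => [z|] //= ne_yz.
have [y_ok eq_y] := track_sound x_ok def_y.
have [z_ok eq_z] := track_sound x_ok def_z.
by apply: contraNneq ne_yz => eq_wv; apply/eqP/vtx_of_code_inj; rewrite // -eq_y eq_wv.
Qed.

End Tracking.

Definition cyclically_reduced : pred (seq color) := path.cycle (fun i j => i != j).

Definition circuit m w := [&& size w == m, cyclically_reduced w & relator w].

(** This transfers one evaluation to all the sizes that fit the model. *)
Lemma no_circuit_sound Q D B h w : fits_model Q D -> 2 < h ->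
  no_circuit Q D B h -> circuit h.*2 w -> ~~ prefix3 B w.
Proof.
move=> fitQD h_gt2 no_circ /and3P[/eqP sz_w cyc_w rel_w].
have h_gt0 : 0 < h by apply: leq_trans h_gt2.
have <- : prefix3 B (take h w) = prefix3 B w.
  by case: (h) h_gt2 => [|[|[|h']]] // _; case: (w) => [|i [|j [|k w']]].
have def_w := cat_take_drop h w.
set w1 := take h w in def_w *; set w2 := drop h w in def_w.
have sz1 : size w1 = h by rewrite size_takel // sz_w -addnn leq_addr.
have sz2 : size w2 = h by rewrite size_drop sz_w -addnn addnK.
have red w' : reduced w' -> size w' = h -> w' \in reduced_words h.
  by move=> red_w <-; apply: mem_reduced_words.
have [i [u def1]] : exists i u, w1 = i :: u.
  by case: (w1) sz1 h_gt0 => [<- | i u] //; exists i, u.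
have [k [v def2]] : exists k v, w2 = rcons v k.
  by case/lastP: (w2) sz2 h_gt0 => [<- | v k] //; exists k, v.
have /and3P[p1 p2 ends] : [&& reduced w1, reduced w2 & (last i u != head k w2) && (k != i)].
  move: cyc_w; rewrite -def_w def1 /cyclically_reduced /= rcons_cat cat_path.
  case/andP=> -> /=; rewrite def2; case: v {def2} => [|j v] /=.
    by rewrite !andbT.
  by rewrite rcons_path last_rcons => /and3P[-> -> ->].
apply/negP=> bad_w1; have := @codes_valid Q; rewrite /no_circuit in no_circ.
move: (codes Q) no_circ => cs no_circ cs_ok.
move/allP/(_ (w1, [seq track Q D false w1 x | x <- cs])): no_circ.
rewrite map_f ?red //= bad_w1 => /(_ isT) /allP.
move/(_ (rev w2, [seq track Q D false (rev w2) x | x <- cs])).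
rewrite (map_f (fun w => (w, [seq track Q D false w x | x <- cs]))); last first.
  rewrite red ?size_rev // /reduced rev_sorted.
  by rewrite (eq_sorted (e' := fun i j => i != j)) // => ? ?; rewrite eq_sym.
move/(_ isT) => /=; rewrite revK => /or3P[||].
- by rewrite def1 def2 rev_rcons /= => /eqP[/esym/eqP]; case/andP: ends => _ /negPf->.
- rewrite def1 lastI rev_rcons; case/andP: ends => + _.
  by case: (w2) sz2 => [|j w2'] //= _ /negPf ne /eqP[/eqP]; rewrite ne.
move: rel_w; rewrite -def_w relator_halves ?sz1 ?sz2 // => /eqP eq_sw.
rewrite zip_map => /hasP[xy /mapP[z z_in ->]] /=.
by move/(clash_sound fitQD (cs_ok _ z_in)); rewrite eq_sw eqxx.
Qed.

End Sweep.

(** * Families of relators *)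

Section Relators.

Variables a b : nat.
Hypothesis a_gt0 : 0 < a.

Local Notation n := (theta_n a b).
Local Notation V := 'I_n.+1.
Local Notation q := (inner_size a b).
Local Notation vtx := (vertex a b).
Local Notation slide := (slide_perm a b).
Local Notation sweep := (@word_perm a b).
Local Notation relator := (@is_relator a b).
Local Notation hub0 := (vtx Lft 0).
Local Notation hub1 := (vtx Lft a.+1).

Lemma slideV_1 k : (slide k)^-1%g (vtx k 1) = hub0.
Proof. by rewrite slideV_vtx // vtx0. Qed.

Lemma slide_last k : slide k (vtx k (q k)) = hub1.
Proof. by rewrite slide_vtx // vtx_end. Qed.

Lemma color3 (i j k l : color) : i != j -> j != k -> i != k ->
  [|| l == i, l == j | l == k].
Proof. by case: i j k l => [] [] [] []. Qed.

Local Notation first k := (vtx k 1).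
Local Notation final k := (vtx k (q k)).

(** The word is the commutator of the loops [i j] and [k i], read as products of
    an inverse slide and a slide.  It undoes most of what it does: followed
    through the six slides, only two neighbours of the first hub, the second
    hub and one of its neighbours are not brought back. *)
Lemma double_tour i j k : i != j -> j != k -> i != k ->
    0 < q i -> 0 < q j -> 0 < q k ->
  sweep false [:: i; j; k; i; j; k]
    = (tperm (first i) (first k) * tperm hub1 (final j))%g.
Proof.
move=> ne_ij ne_jk ne_ik qi qj qk.
have ne_ji : j != i by rewrite eq_sym.
have ne_kj : k != j by rewrite eq_sym.
have ne_ki : k != i by rewrite eq_sym.
apply/permP=> v; rewrite /= mulg1 !permM.
case: (vtxP v) => [||l m le_m].
- rewrite !(slideV_hub0, slide_hub1) !tpermD //; vneq.
- rewrite slideV_hub1 !slide_other //; try lia.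
  rewrite slideV_other //; try lia.
  rewrite slide_last slideV_hub1 slide_other //; try lia.
  by rewrite [tperm (first i) _ _]tpermD ?tpermL //; vneq.
case/or3P: (color3 l ne_ij ne_jk ne_ik) => /eqP eq_l; rewrite {l}eq_l in le_m *.
- have [-> | m_gt1] := eqVneq m 1.
    rewrite slideV_1 slide_hub0 slideV_other // slide_other // slideV_1 slide_hub0.
    by rewrite tpermL tpermD //; vneq.
  case: m le_m m_gt1 => [|m] le_m m_gt1; first by lia.
  rewrite slideV_vtx; last by lia.
  rewrite slide_other //; last by lia.
  rewrite slideV_other //; last by lia.
  rewrite slide_vtx; last by lia.
  rewrite slideV_other // slide_other //.
  by rewrite !tpermD //; vneq.
- rewrite slideV_other //.
  have [-> | ne_m] := eqVneq m (q j).
    rewrite slide_last slideV_hub1 slide_other //; last by lia.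
    rewrite slideV_other //; last by lia.
    by rewrite slide_last [tperm (first i) _ _]tpermD ?tpermR //; vneq.
  rewrite slide_vtx; last by lia.
  rewrite slideV_other //; last by lia.
  rewrite slide_other //; last by lia.
  rewrite slideV_vtx; last by lia.
  rewrite slide_other //; try lia.
  by rewrite !tpermD //; vneq.
- rewrite slideV_other // slide_other //.
  have [-> | m_gt1] := eqVneq m 1.
    rewrite slideV_1 slide_hub0 slideV_other // slide_other //.
    by rewrite tpermR tpermD //; vneq.
  case: m le_m m_gt1 => [|m] le_m m_gt1; first by lia.
  rewrite slideV_vtx; last by lia.
  rewrite slide_other //; last by lia.
  rewrite slideV_other //; last by lia.
  rewrite slide_vtx; last by lia.
  by rewrite !tpermD //; vneq.
Qed.

(** If path [j] is a single edge, the second hub is carried across it to a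
    neighbour of the first, and the moved vertices form one 3-cycle. *)
Lemma double_tour_empty i j k : i != j -> j != k -> i != k ->
    0 < q i -> q j = 0 -> 0 < q k ->
  sweep false [:: i; j; k; i; j; k]
    = (tperm hub1 (first k) * tperm hub1 (first i))%g.
Proof.
move=> ne_ij ne_jk ne_ik qi qj qk.
have ne_ji : j != i by rewrite eq_sym.
have ne_kj : k != j by rewrite eq_sym.
have ne_ki : k != i by rewrite eq_sym.
have slide_j0 : slide j hub0 = hub1 by rewrite slide_hub0 -(vtx_end a b j) qj.
have slideV_j1 : (slide j)^-1%g hub1 = hub0 by rewrite slideV_hub1 qj vtx0.
apply/permP=> v; rewrite /= mulg1 !permM.
case: (vtxP v) => [||l m le_m].
- rewrite !(slideV_hub0, slide_hub1) !tpermD //; vneq.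
- rewrite slideV_hub1 slide_other //; try lia.
  rewrite slideV_other //; try lia.
  rewrite slide_last slideV_j1 slide_hub0.
  by rewrite tpermL tpermD //; vneq.
case/or3P: (color3 l ne_ij ne_jk ne_ik) => /eqP eq_l; rewrite {l}eq_l in le_m *.
- have [-> | m_gt1] := eqVneq m 1.
    rewrite slideV_1 slide_j0 slideV_hub1 slide_other //; try lia.
    rewrite slideV_other //; try lia.
    by rewrite slide_last [tperm hub1 (first k) _]tpermD ?tpermR //; vneq.
  case: m le_m m_gt1 => [|m] le_m m_gt1; first by lia.
  rewrite slideV_vtx; last by lia.
  rewrite slide_other //; last by lia.
  rewrite slideV_other //; last by lia.
  rewrite slide_vtx; last by lia.
  rewrite slideV_other // slide_other //.
  by rewrite !tpermD //; vneq.
- by lia.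
- rewrite slideV_other // slide_other //.
  have [-> | m_gt1] := eqVneq m 1.
    rewrite slideV_1 slide_hub0 slideV_other // slide_other //.
    by rewrite tpermR tpermL.
  case: m le_m m_gt1 => [|m] le_m m_gt1; first by lia.
  rewrite slideV_vtx; last by lia.
  rewrite slide_other //; last by lia.
  rewrite slideV_other //; last by lia.
  rewrite slide_vtx; last by lia.
  by rewrite !tpermD //; vneq.
Qed.

Definition spin m (i j k : color) := flatten (nseq m [:: i; j; k]).

Lemma size_spin m i j k : size (spin m i j k) = m * 3.
Proof. by elim: m => // m IHm; rewrite /spin /= -/(spin m i j k) IHm. Qed.

Lemma spin_rot m i j k : k :: spin m i j k ++ [:: i; j] = spin m.+1 k i j.
Proof. by elim: m => // m IHm; rewrite {1}/spin /= -/(spin m i j k) IHm. Qed.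

Lemma spinSr m i j k : spin m i j k ++ [:: i; j; k] = spin m.+1 i j k.
Proof. by elim: m => // m IHm; rewrite {1}/spin /= -/(spin m i j k) IHm. Qed.

Lemma rev_spin m i j k : rev (spin m i j k) = spin m k j i.
Proof.
elim: m => // m IHm; rewrite {1}/spin /= -/(spin m i j k) !rev_cons IHm.
by rewrite -spinSr -!cats1 -!catA.
Qed.

(** Cutting two letters off one end and gluing them to the other is a conjugation
    for words of even length, and reversal is inversion.  Together they reach all six orders of
    the colours. *)
Lemma spin_rel_all m i j k : ~~ odd m -> relator (spin m Lft Mid Rgt) ->
  i != j -> j != k -> i != k -> relator (spin m i j k).
Proof.
move=> even_m rel_m.
have rot2 x y z : relator (spin m x y z) -> relator (spin m z x y).
  case: m even_m {rel_m} => // m even_m.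
  rewrite -(spin_rot m x y z) -cat1s catA relator_catC //=.
  by rewrite size_spin oddM andbT.
have rev3 x y z : relator (spin m x y z) -> relator (spin m z y x).
  by rewrite -rev_spin relator_rev // size_spin oddM andbT.
have rel_m2 := rot2 _ _ _ rel_m; have rel_m3 := rot2 _ _ _ rel_m2.
by case: i j k => [] [] [] // _ _ _; apply: rev3.
Qed.

Lemma spin4_rel i j k : 0 < b -> i != j -> j != k -> i != k -> relator (spin 4 i j k).
Proof.
move=> b_gt0; apply: spin_rel_all => //.
set d := [:: Lft; Mid; Rgt; Lft; Mid; Rgt].
rewrite /is_relator -[spin _ _ _ _]/(d ++ d).
rewrite sweep_cat addbF double_tour // tperm2_sq //; vneq.
Qed.

Lemma spin6_rel i j k : b = 0 -> i != j -> j != k -> i != k -> relator (spin 6 i j k).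
Proof.
move=> b0; apply: spin_rel_all => //.
set d := [:: Lft; Mid; Rgt; Lft; Mid; Rgt].
rewrite /is_relator -[spin _ _ _ _]/(d ++ d ++ d).
rewrite !sweep_cat !addbF double_tour_empty // mulgA tperm3_cube //; vneq.
Qed.

(** In such a word the middle path is always followed in the same direction. *)
Definition ladder (xs : seq color) := flatten [seq [:: x; Mid] | x <- xs].

(** The inner vertices of an outer path, as an interval of indices. *)
Definition on_side x (v : nat) :=
  match x with Lft => 0 < v <= a | Mid => false | Rgt => a + 2 <= v <= 2 * a + 1 end.

(** Position on the circle of [a + b + 1] vertices formed by an outer path, the
    middle path and the second hub; the two outer paths are numbered in
    parallel. *)
Definition height (v : nat) :=
  if v <= a then a - v else if v == a + 1 then a + b else v - (a + 2).

Local Notation N := (a + b + 1).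

Lemma height_lt (v : V) : v != hub0 -> height v < N.
Proof.
rewrite -val_eqE /= vtxE //= => ne_v.
by rewrite /height; have : v < (2 * a + b + 1).+1 := ltn_ord v; do 2?case: ifP; lia.
Qed.

(** Each step of a ladder turns one of the two circles by one place and leaves
    the other outer path alone. *)
Lemma ladder_step x (v : V) : x != Mid -> v != hub0 ->
  let u := sweep false [:: x; Mid] v in
  u != hub0 /\
  if on_side (bar x) v then u = v
  else ~~ on_side (bar x) u /\ height u = (height v).+1 %% N.
Proof.
move=> neM ne_v u; rewrite {}/u /= mulg1 permM.
have side_lr k i : 0 < i <= q k -> on_side (bar x) (vtx k i) = (k == bar x).
  move=> le_i; rewrite vtxE; last by lia.
  rewrite [k == _]/(color_eqb k _).
  by case: (x) neM => // _; case: k le_i => /= le_i; repeat case: ifP; lia.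
have height_x k i : k != Mid -> 0 < i <= a -> height (vtx k i) = a - i.
  move=> neM' le_i; have qk : q k = a by case: k neM'.
  rewrite vtxE ?qk; last by lia.
  by case: k neM' {qk} => //= _; rewrite /height; repeat case: ifP; lia.
have height_M i : 0 < i <= b -> height (vtx Mid i) = a + i - 1.
  by move=> le_i; rewrite vtxE /=; rewrite /height; repeat case: ifP; lia.
have height_1 : height hub1 = a + b.
  by rewrite vtxE //= /height; repeat case: ifP; lia.
have side_1 : ~~ on_side (bar x) hub1.
  by rewrite vtxE //=; case: (x) neM => //= _; lia.
have qx : q x = a by case: (x) neM.
have ne_Mx : Mid != x by rewrite eq_sym.
case: (vtxP v) ne_v => [/eqP // | _ | k i le_i _].
- rewrite (negPf side_1) slideV_hub1 qx slide_other //; last by rewrite qx; lia.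
  split; first by apply: inner_neq_hub0; rewrite qx; lia.
  rewrite side_lr; last by rewrite qx; lia.
  by split; [case: (x) neM | rewrite height_1 height_x ?a_gt0 ?leqnn // subnn -addn1 modnn].
rewrite side_lr //; have [eq_k | ne_k] := eqVneq k (bar x).
  have ne_kx : x != k by rewrite eq_k; case: (x) neM.
  have ne_kM : Mid != k by rewrite eq_k; case: (x) neM.
  by rewrite slideV_other // slide_other //; split=> //; apply: inner_neq_hub0.
have [eq_kx | ne_kx] := eqVneq k x.
  rewrite eq_kx in le_i *; have [-> | ne_i] := eqVneq i 1.
    rewrite slideV_1 slide_hub0; have [b0 | b_gt0] := posnP b.
      have -> : vtx Mid 1 = hub1 by rewrite -(vtx_end a b Mid) /= b0.
      rewrite side_1 height_1 height_x //; try lia.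
      rewrite modn_small; last by lia.
      by split; [rewrite eq_sym hub_neq | split=> //; lia].
    rewrite side_lr // height_M // height_x //; try lia.
    rewrite modn_small; last by lia.
    split; first by apply: inner_neq_hub0.
    by split; [case: (x) neM | lia].
  case: i le_i ne_i => [|i] le_i ne_i; first by lia.
  rewrite slideV_vtx; last by lia.
  rewrite slide_other //; try lia.
  rewrite side_lr; last by lia.
  rewrite !height_x //; try lia.
  rewrite modn_small; last by lia.
  split; first by apply: inner_neq_hub0; lia.
  by split; [case: (x) neM | lia].
have eq_kM : k = Mid by case: (x) k neM ne_k ne_kx {le_i} => [] [].
rewrite eq_kM in le_i *; have {}le_i : 0 < i <= b := le_i.
rewrite slideV_other //; have [eq_i | ne_i] := eqVneq i b.
  rewrite eq_i -[b in vtx Mid b]/(q Mid) slide_last side_1 height_1.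
  rewrite height_M; last by rewrite /=; lia.
  rewrite [q Mid]/= modn_small; last by lia.
  by split; [rewrite eq_sym hub_neq | split=> //; lia].
rewrite slide_vtx; last by rewrite /=; lia.
have le_i1 : 0 < i.+1 <= b by lia.
rewrite side_lr // !height_M // modn_small; last by lia.
split; first exact: inner_neq_hub0.
by split; [case: (x) neM | lia].
Qed.

Lemma sweep_ladder x xs : sweep false (ladder (x :: xs))
  = (sweep false [:: x; Mid] * sweep false (ladder xs))%g.
Proof. by rewrite -[ladder (x :: xs)]/([:: x; Mid] ++ ladder xs) sweep_cat. Qed.

Lemma ladder_moves xs (v : V) : Mid \notin xs -> v != hub0 ->
  exists m, [/\ m <= size xs,
    height (sweep false (ladder xs) v) = (height v + m) %% N
  & m = 0 -> all (fun x => on_side (bar x) v) xs].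
Proof.
elim: xs v => [|x xs IHxs] v.
  by exists 0; rewrite perm1 addn0 modn_small ?height_lt.
rewrite inE negb_or eq_sym => /andP[neM xs'M] ne_v.
have [] := ladder_step neM ne_v.
rewrite sweep_ladder permM.
move: (_ v) => u ne_u; case: ifP => side_v.
  move=> eq_u; rewrite eq_u in ne_u *; have [m [le_m eq_m idle]] := IHxs v xs'M ne_u.
  by exists m; split=> // [|/idle all_xs]; [exact: leqW | rewrite /= side_v].
case=> _ eq_u; have [m [le_m eq_m idle]] := IHxs u xs'M ne_u.
by exists m.+1; split=> //; rewrite eq_m eq_u modnDml addSnnS.
Qed.

(** A vertex that returns to its place has made a number of moves divisible by
    [N], out of at most [N].  A vertex of the outer path not used by the first step
    is idle at least once; hence it never moves, and no step uses its path. *)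
Lemma ladder_rigid xs : Mid \notin xs -> size xs = N -> relator (ladder xs) ->
  forall x y, x \in xs -> y \in xs -> x = y.
Proof.
case: xs => // x0 xs; rewrite inE negb_or eq_sym => /andP[neM xs'M] sz_xs.
have {}sz_xs : size xs = a + b by move: sz_xs => /=; lia.
rewrite /is_relator sweep_ladder => /eqP rel_xs.
pose v := vtx (bar x0) 1.
have q0 : q (bar x0) = a by case: (x0) neM.
have ne_v : v != hub0 by apply: inner_neq_hub0; rewrite q0.
have side_v x : x != Mid -> on_side (bar x) v = (x == x0).
  rewrite /v vtxE ?q0 // [x == x0]/(color_eqb x x0).
  by case: (x0) neM => // _; case: x => //= _; lia.
have [_] := ladder_step neM ne_v; rewrite side_v // eqxx => eq_v.
(* The first step does not move [v], so [m] counts at most [N - 1] moves. *)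
have [m [le_m eq_m idle]] := ladder_moves xs'M ne_v.
have /idle all_x0 : m = 0.
  move: eq_m; rewrite -{1}eq_v -permM rel_xs perm1 => eq_m.
  have: height v + m = height v + 0 %[mod N].
    by rewrite addn0 -eq_m modn_small ?height_lt.
  by move/eqP; rewrite eqn_modDl mod0n modn_small; [move/eqP | lia].
have all0 x : x \in x0 :: xs -> x = x0.
  rewrite inE => /orP[/eqP-> // | xs_x]; apply/eqP; rewrite -side_v.
    exact: (allP all_x0).
  by apply: contraNneq xs'M => <-.
by move=> x y /all0-> /all0->.
Qed.

Lemma ladder_rel x : x != Mid -> relator (ladder (nseq N x)).
Proof.
move=> neM; apply/eqP/permP=> v; rewrite perm1.
have [-> | ne_v] := eqVneq v hub0.
  elim: N => [|m IHm]; first by rewrite perm1.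
  by rewrite sweep_ladder permM /= mulg1 permM slideV_hub0 slide_hub1.
have [side_v | side'v] := boolP (on_side (bar x) v).
  elim: N => [|m IHm]; first by rewrite perm1.
  rewrite sweep_ladder permM.
  by have [_] := ladder_step neM ne_v; rewrite side_v => ->.
have moves m u : u != hub0 -> ~~ on_side (bar x) u ->
    let u' := sweep false (ladder (nseq m x)) u in
    [/\ u' != hub0, ~~ on_side (bar x) u' & height u' = (height u + m) %% N].
  elim: m u => [|m IHm] u ne_u side'u.
    by rewrite perm1 addn0 modn_small ?height_lt.
  rewrite [nseq _ _]/= sweep_ladder permM.
  have [ne_u1] := ladder_step neM ne_u; rewrite (negPf side'u) => -[side'u1 eq_u1].
  have [ne_u2 side'u2 eq_u2] := IHm _ ne_u1 side'u1.
  by split; rewrite // eq_u2 eq_u1 modnDml addSnnS.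
have [] := moves N v ne_v side'v; move: (sweep _ _ _) => u ne_u side'u.
rewrite modnDr modn_small ?height_lt // => eq_u; apply: val_inj => /=.
move: ne_u ne_v side'u side'v eq_u; rewrite -!val_eqE /= !vtxE //= /height.
have lt_u : u < (2 * a + b + 1).+1 := ltn_ord u.
have lt_v : v < (2 * a + b + 1).+1 := ltn_ord v.
by case: (x) neM => //= _; repeat case: ifP; lia.
Qed.

Lemma triangle : a = 1 -> sweep false [:: Lft; Rgt]
  = (tperm hub1 (first Lft) * tperm hub1 (first Rgt))%g.
Proof.
move=> a1; have eq_end k : k != Mid -> vtx k 2 = hub1.
  by move=> neM; rewrite -(vtx_end a b k); congr vertex; case: k neM; rewrite /= ?a1.
apply/permP=> v; rewrite /= mulg1 !permM.
case: (vtxP v) => [||l m le_m].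
- by rewrite slideV_hub0 slide_hub1 !tpermD //; vneq.
- have -> : (slide Lft)^-1%g hub1 = first Lft.
    by rewrite slideV_hub1; congr vertex; rewrite /= a1.
  rewrite slide_other ?a_gt0 //.
  by rewrite tpermL tpermD //; vneq.
case: l le_m => /= le_m.
- have -> : m = 1 by lia.
  by rewrite slideV_1 slide_hub0 tpermR tpermL.
- by rewrite slideV_other ?slide_other // !tpermD //; vneq.
have -> : m = 1 by lia.
rewrite slideV_other ?a_gt0 // slide_vtx ?a_gt0 // eq_end //.
by rewrite [tperm hub1 (first Lft) _]tpermD ?tpermR //; vneq.
Qed.

Lemma hexagon_rel : a = 1 -> relator [:: Lft; Rgt; Lft; Rgt; Lft; Rgt].
Proof.
move=> a1; pose d := [:: Lft; Rgt].
rewrite /is_relator -[word_perm _ _ _ _]/(sweep false (d ++ d ++ d)).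
rewrite !sweep_cat !addbF triangle // mulgA tperm3_cube //; vneq.
Qed.

End Relators.

Local Open Scope group_scope.

(** * Rigidity of isomorphisms *)

Definition spins_close a b m := forall i j k,
  i != j -> j != k -> i != k -> circuit a b (m * 3)%N (spin m i j k).

(** The patterns of short relators from which rigidity will be derived.  The first
    one recognises whether the outer edges of a path of three edges have the same
    colour.  The other three recognise the edges of colour [Mid]. *)
Variant detectable a b : Prop :=
  | DetectByReturn m of (0 < m)%N & ~~ odd m & spins_close a b m
      & forall w, circuit a b (m * 3)%N w -> ~~ prefix3 returns w
  | DetectByLadder of
      forall w, circuit a b (a + b + 1)%N.*2 w -> ~~ prefix3 avoids_mid w
  | DetectByZigzag m of (0 < m)%N & (a + b + 1)%N.*2 = (m * 3)%N & spins_close a b m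
      & forall w, circuit a b (a + b + 1)%N.*2 w -> ~~ prefix3 zigzags w
  | DetectByHexagon of circuit a b 6 [:: Lft; Rgt; Lft; Rgt; Lft; Rgt]
      & forall w, circuit a b 6 w -> prefix3 avoids_mid w.

Section Rigidity.

Variables a b : nat.
Hypothesis a_gt0 : 0 < a.

Local Notation relator := (@is_relator a b).
Local Notation circuit := (@circuit a b).
Local Notation N := (a + b + 1)%N.

Variables (gT : finGroupType) (s t : color -> gT) (f : gT -> gT).

Hypothesis (t_inj : injective t) (s_inj : injective s) (f_inj : injective f).
Hypothesis (sV : forall k, s (bar k) = (s k)^-1) (tV : forall k, t k * t k = 1).
Hypothesis f_edge : forall g k, exists j, f (s k * g) = t j * f g.

Implicit Types (g h y : gT) (w : seq color).

(** The edge of colour [k] at [g] is mapped to an edge of this colour at [f g];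
    one exists by [f_edge]. *)
Definition image_color g k : color :=
  head Rgt [seq j <- palette | f (s k * g) == t j * f g].

Lemma image_colorP g k : f (s k * g) = t (image_color g k) * f g.
Proof.
have [j f_j] := f_edge g k; rewrite /image_color /palette /=.
case: eqP => //= neL; case: eqP => //= neM; case: eqP => //= neR.
by case: j f_j.
Qed.

Lemma image_color_inj g : injective (image_color g).
Proof.
move=> i j eq_ij; apply: s_inj; apply: (@mulIg _ g).
by apply: f_inj; rewrite !image_colorP eq_ij.
Qed.

(** The same edge seen from its other end, where it bears the colour [bar k]
    and its image has kept its colour. *)
Lemma image_color_bar g k : image_color (s k * g) (bar k) = image_color g k.
Proof.
have := image_colorP (s k * g) (bar k); rewrite sV mulKg (image_colorP g k) mulgA => eq_f.
apply: t_inj; apply: (@mulIg _ (t (image_color g k))); rewrite tV.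
by apply: (@mulIg _ (f g)); rewrite mul1g -eq_f.
Qed.

(** Words name edges by their colour at the even vertices of the walk, so at the
    odd ones the colour has to be translated by [bar]. *)
Fixpoint walk (l : bool) w g :=
  if w is k :: w' then let k' := if l then bar k else k in walk (~~ l) w' (s k' * g)
  else g.

Fixpoint image_word (l : bool) w g : seq color :=
  if w is k :: w' then
    let k' := if l then bar k else k in image_color g k' :: image_word (~~ l) w' (s k' * g)
  else [::].

Definition twalk w h := foldl (fun h k => t k * h) h w.

Lemma size_image l w g : size (image_word l w g) = size w.
Proof. by elim: w l g => //= k w IHw l g; rewrite IHw. Qed.

Lemma image_rcons l w k g : image_word l (rcons w k) g
  = rcons (image_word l w g) (image_color (walk l w g) (if l (+) odd (size w) then bar k else k)).
Proof.
elim: w l g => [|j w IHw] l g /=; first by rewrite addbF.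
by rewrite IHw addbN addNb.
Qed.

Lemma walk_image l w g : f (walk l w g) = twalk (image_word l w g) (f g).
Proof. by elim: w l g => //= k w IHw l g; rewrite IHw image_colorP. Qed.

Lemma image_reduced l w g : reduced w -> reduced (image_word l w g).
Proof.
case: w => //= k w; elim: w k l g => //= k w IHw j l g /andP[ne_jk /IHw red_w].
rewrite {}red_w andbT.
have -> : (if ~~ l then bar k else k) = bar (if l then bar k else k).
  by case: l; rewrite ?barK.
set j' := (if l then bar j else j); rewrite -(image_color_bar g j') (inj_eq (@image_color_inj _)).
by rewrite (inj_eq (can_inj barK)) {}/j'; case: l; rewrite ?(inj_eq (can_inj barK)).
Qed.

Hypothesis rel_s : forall w g, ~~ odd (size w) -> relator w -> walk false w g = g.
Hypothesis rel_t : forall w h, ~~ odd (size w) -> twalk w h = h -> relator w.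

Lemma image_rel w g : ~~ odd (size w) -> relator w -> relator (image_word false w g).
Proof.
move=> even_w rel_w; apply: (@rel_t _ (f g)); first by rewrite size_image.
by rewrite -walk_image rel_s.
Qed.

(** The closed walk ends at [g], at an even place: therefore the last letter
    of the image and its first letter are compared at the same vertex, as cyclic
    reduction requires. *)
Lemma image_circuit m w g : ~~ odd m -> circuit m w -> circuit m (image_word false w g).
Proof.
move=> even_m /and3P[/eqP sz_w cyc_w rel_w]; rewrite -sz_w in even_m *.
apply/and3P; split; [by rewrite size_image | | exact: image_rel].
case: w even_m cyc_w rel_w {sz_w} => // k w even_w cyc_w rel_w.
have := @image_reduced false (rcons (k :: w) k) g cyc_w.
by rewrite image_rcons (negPf even_w) rel_s.
Qed.

(** Crossing an edge, two edges of the same colour carry names that differ by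
    [bar]; rigidity says that their images have equal colours. *)
Definition rigid := forall y j k, image_color (s j * y) k = image_color y (bar k).

(** Words start at even vertices, so a statement about an edge leaving [y] is
    proved from the vertex [x] that precedes [y] on the walk. *)
Lemma from_before (i : color) y : exists2 x, s i * x = y & image_color x i = image_color y (bar i).
Proof.
exists ((s i)^-1 * y); first exact: mulKVg.
by rewrite -(image_color_bar _ i) mulKVg.
Qed.

Lemma inj_other (p : color -> color) c i j k : injective p ->
  i != j -> j != k -> i != k -> c != p i -> c != p j -> c = p k.
Proof.
move=> p_inj ne_ij ne_jk ne_ik ne_i ne_j.
have := inj_eq p_inj i j; have := inj_eq p_inj j k; have := inj_eq p_inj i k.
rewrite (negPf ne_ij) (negPf ne_jk) (negPf ne_ik).
by move: ne_i ne_j; case: (p i); case: (p j); case: (p k); case: c.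
Qed.

(** The spin through the edges [i], [j], [k] is mapped to a circuit, so the images of [i]
    and [k] differ.  Hence for equal outer colours the images are equal, since
    only three colours are available. *)
Lemma rigid_of_no_return m : 0 < m -> ~~ odd m ->
    spins_close a b m ->
    (forall w, circuit (m * 3)%N w -> ~~ prefix3 returns w) ->
  rigid.
Proof.
case: m => // m _ even_m spin_circ no_return.
have even_m3 : ~~ odd (m.+1 * 3)%N by rewrite oddM andbT.
have ne_third y i j k : i != j -> j != k -> i != k ->
    image_color y (bar i) != image_color (s (bar j) * y) k.
  move=> ne_ij ne_jk ne_ik; have [x def_y <-] := from_before i y.
  have := image_circuit x even_m3 (spin_circ i j k ne_ij ne_jk ne_ik).
  by move/no_return; rewrite /= def_y.
have ne_bar i j : (bar i != bar j) = (i != j) by rewrite (inj_eq (can_inj barK)).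
have rigid_ne y j k : k != bar j -> image_color (s j * y) k = image_color y (bar k).
  rewrite -{2}(barK j); set j' := bar j => ne_kj.
  have [i ne_ij ne_ik] : exists2 i, i != j' & i != k.
    by case: (k) (j') ne_kj => [] [] // _;
      [exists Rgt | exists Mid | exists Rgt | exists Lft | exists Mid | exists Lft].
  apply: (@inj_other (image_color y) _ (bar i) (bar j') (bar k));
    rewrite ?ne_bar // 1?eq_sym //.
  - exact: image_color_inj.
  - by apply: ne_third => //; rewrite eq_sym.
  rewrite -(image_color_bar y (bar j')) barK (inj_eq (@image_color_inj _)) eq_sym //.
move=> y j k; have [-> | ne_k] := eqVneq k (bar j); last exact: rigid_ne.
by rewrite image_color_bar barK.
Qed.

(** If [Mid] is preserved, a ladder is mapped to a ladder, and by [ladder_rigid]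
    the latter has only one colour besides [Mid].  This gives rigidity across the edges of
    colour [Mid]; across the others only one more colour is left to choose. *)
Lemma rigid_of_mid : (forall y, image_color y Mid = Mid) -> rigid.
Proof.
move=> fix_mid.
have swap_mid y : image_color (s Mid * y) Lft = image_color y Rgt.
  have [x def_y <-] := from_before Lft y.
  have N_gt1 : (1 < N)%N by lia.
  have image_ladder ks g : Mid \notin ks ->
      exists xs, [/\ image_word false (ladder ks) g = ladder xs, size xs = size ks & Mid \notin xs].
    elim: ks g => [|k ks IHks] g; first by exists [::].
    rewrite inE negb_or eq_sym => /andP[neM /IHks{IHks}IHks].
    have [xs [eq_im sz_xs xs'M]] := IHks (s Mid * (s k * g)).
    exists (image_color g k :: xs); split; rewrite /= ?sz_xs //.
      by rewrite eq_im fix_mid.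
    by rewrite inE negb_or -{1}(fix_mid g) (inj_eq (@image_color_inj _)) eq_sym neM.
  have M'nseq : Mid \notin nseq N Lft by rewrite mem_nseq andbF.
  have [xs [eq_im sz_xs xs'M]] := image_ladder _ x M'nseq.
  have rel_xs : relator (ladder xs).
    rewrite -eq_im; apply: image_rel; last exact: ladder_rel.
    by elim: N => // m IHm; rewrite /= negbK.
  rewrite size_nseq in sz_xs.
  have all_eq := ladder_rigid a_gt0 xs'M sz_xs rel_xs.
  move: eq_im sz_xs all_eq {xs'M rel_xs M'nseq image_ladder}.
  case: N N_gt1 => // -[|N'] // _; case: xs => [|x1 [|x2 xs]] // eq_im _ all_eq.
  move: eq_im; rewrite /= def_y => -[-> _ -> _ _].
  by apply: all_eq; rewrite !inE eqxx ?orbT.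
have other y z c : c != Mid -> image_color z c = image_color y (bar c) ->
    image_color z (bar c) = image_color y c.
  move=> neM eq_c; have ne_cb : bar c != c by case: (c) neM.
  have ne_bM : bar c != Mid by case: (c) neM.
  apply: (@inj_other (image_color y) _ (bar c) Mid c); rewrite 1?eq_sym //.
  - exact: image_color_inj.
  - by rewrite eq_sym.
  - by rewrite -eq_c eq_sym (inj_eq (@image_color_inj _)).
  by rewrite fix_mid -{1}(fix_mid z) (inj_eq (@image_color_inj _)) eq_sym.
move=> y j [] /=; try by rewrite !fix_mid.
- case: j; [|exact: swap_mid|exact: image_color_bar].
  by apply: (other _ _ Rgt) => //; apply: image_color_bar.
case: j; [exact: image_color_bar| |].
  by apply: (other _ _ Lft) => //; apply: swap_mid.
by apply: (other _ _ Lft) => //; apply: image_color_bar.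
Qed.

Lemma ladder_circuit k : k != Mid -> circuit N.*2 (ladder (nseq N k)).
Proof.
move=> neM; apply/and3P; split; last exact: ladder_rel.
  by elim: N => // m IHm; rewrite [size _]/=.
have ne_Mk : Mid != k by rewrite eq_sym.
rewrite addn1 /cyclically_reduced /= neM /=.
by elim: (a + b)%N => [|m IHm] /=; rewrite ne_Mk ?neM.
Qed.

Let even_ladder : ~~ odd N.*2. Proof. by rewrite odd_double. Qed.

Lemma ladder_image k x : k != Mid ->
  exists w, circuit N.*2
    [:: image_color x k, image_color (s k * x) Mid,
        image_color (s Mid * (s k * x)) k & w].
Proof.
move=> neM; have := image_circuit x even_ladder (ladder_circuit neM).
have : (1 < N)%N by lia.
by case: N => // -[|N'] // _ /= circ; eexists; exact: circ.
Qed.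

Lemma fix_mid_of_side y :
    (forall k, k != Mid -> image_color y k = Mid \/ image_color y Mid = Mid) ->
  image_color y Mid = Mid.
Proof.
move=> side; case: (side Lft isT) => // eqL; case: (side Rgt isT) => // eqR.
by have /image_color_inj := etrans eqL (esym eqR).
Qed.

(** Every corner made of an outer edge and a middle edge lies on a ladder, but no
    circuit of that length has a corner made of two outer edges.  So at each
    vertex both corners at the middle edge keep a middle edge, and this must be
    the image of their common edge. *)
Lemma rigid_of_ladder_start :
  (forall w, circuit N.*2 w -> ~~ prefix3 avoids_mid w) -> rigid.
Proof.
move=> no_LR; apply: rigid_of_mid => y; apply: fix_mid_of_side => k neM.
have [x def_y eq_x] := from_before (bar k) y; rewrite barK in eq_x.
have nebM : bar k != Mid by case: (k) neM.
have [w /no_LR] := ladder_image x nebM; rewrite /= def_y eq_x negb_and !negbK.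
by case/orP=> /eqP; [left | right].
Qed.

(** A corner made of an outer edge and a middle edge can be continued in both
    possible ways, by a ladder and by a spin.  A corner made of two outer
    edges can be continued in one way only, as zigzags are excluded. *)
Lemma rigid_of_no_zigzag m : (0 < m)%N -> N.*2 = (m * 3)%N ->
    spins_close a b m ->
    (forall w, circuit N.*2 w -> ~~ prefix3 zigzags w) ->
  rigid.
Proof.
case: m => // m _ eq_m spin_circ no_zz; apply: rigid_of_mid => y.
apply: fix_mid_of_side => k neM.
have [x def_y eq_x] := from_before (bar k) y; rewrite barK in eq_x.
have nebM : bar k != Mid by case: (k) neM.
have ne_bk : bar k != k by case: (k) neM.
have [w1 /no_zz] := ladder_image x nebM.
have := image_circuit x _ (spin_circ (bar k) Mid k nebM _ ne_bk).
rewrite -eq_m odd_double eq_sym neM => /(_ isT isT)/no_zz.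
rewrite /zigzags /= def_y eq_x.
set z := s Mid * y; set c := image_color y k; set d := image_color y Mid.
have [-> | ne_cM] := eqVneq c Mid; first by left.
have [-> | ne_dM] := eqVneq d Mid; first by right.
have ne_cd : c != d by rewrite (inj_eq (@image_color_inj _)).
rewrite /= ne_cd !andbT => ne_1 ne_2; case/eqP: ne_cd.
rewrite -[d](image_color_bar y Mid) -/z; apply: (@inj_other (image_color z) _ (bar k) k Mid) => //.
exact: image_color_inj.
Qed.

Lemma rigid_of_hexagon : circuit 6 [:: Lft; Rgt; Lft; Rgt; Lft; Rgt] ->
  (forall w, circuit 6 w -> prefix3 avoids_mid w) -> rigid.
Proof.
move=> hex starts; apply: rigid_of_mid => y.
have [x def_y eq_x] := from_before Lft y.
have := starts _ (@image_circuit 6 _ x isT hex); rewrite /= def_y eq_x => /andP[ne_R ne_L].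
apply/esym/(@inj_other (image_color y) _ Rgt Lft Mid) => //; rewrite 1?eq_sym //.
exact: image_color_inj.
Qed.

Theorem rigid_of_detectable : detectable a b -> rigid.
Proof.
case=> [m m_gt0 even_m | | m m_gt0 | ].
- exact: rigid_of_no_return.
- exact: rigid_of_ladder_start.
- exact: rigid_of_no_zigzag.
exact: rigid_of_hexagon.
Qed.

(** Two crossings cancel, because [bar] is an involution; a single one does not. *)
Lemma rigid_proper : rigid ->
  exists2 K : {group gT}, forall i j, s i * s j \in K & s Lft \notin K.
Proof.
move=> rig; pose K := [set h |
  [forall g, all (fun k => image_color (h * g) k == image_color g k) palette]].
have KP h : reflect (forall g k, image_color (h * g) k = image_color g k) (h \in K).
  rewrite inE; apply: (iffP forallP) => [K_h g k | fix_h g].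
    by apply/eqP; apply: (allP (K_h g)); case: k.
  by apply/allP=> k _; rewrite fix_h.
have groupK : group_set K.
  apply/group_setP; split; first by apply/KP=> g k; rewrite mul1g.
  by move=> h h' /KP fix_h /KP fix_h'; apply/KP=> g k; rewrite -mulgA fix_h fix_h'.
exists (Group groupK) => [i j | ]; first by apply/KP=> g k; rewrite -mulgA !rig barK.
by apply/KP=> /(_ 1 Lft); rewrite rig => /image_color_inj.
Qed.

End Rigidity.

Local Open Scope nat_scope.

(** * The puzzle group *)

Section Puzzle.

Variables a b : nat.
Hypothesis a_gt0 : 0 < a.

Local Notation n := (theta_n a b).
Local Notation V := 'I_n.+1.
Local Notation q := (inner_size a b).
Local Notation vtx := (vertex a b).
Local Notation slide := (slide_perm a b).
Local Notation sweep := (@word_perm a b).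
Local Notation hub0 := (vtx Lft 0).
Local Notation hub1 := (vtx Lft a.+1).
Local Notation first k := (vtx k 1).
Local Notation final k := (vtx k (q k)).

Variable H : {group {perm V}}.
Hypothesis H_loop : forall i j, ((slide i)^-1 * slide j)%g \in H.
Hypothesis H_hub0 : forall h, h \in H -> h hub0 = hub0.

Local Notation loop i j := ((slide i)^-1 * slide j)%g.

(** The puzzle group [H] fixes the place of the hole; its elements are the
    rearrangements of the tiles obtained by bringing the hole back. *)
Lemma sweep_even w : ~~ odd (size w) -> sweep false w \in H.
Proof.
have [m] := ubnP (size w); elim: m w => // m IHm [|i [|j w]] //= le_w.
by rewrite negbK => even_w; rewrite mulgA groupM ?H_loop ?IHm //; lia.
Qed.

Lemma loop_retreat i j m : i != j -> 0 < m < q i -> loop i j (vtx i m.+1) = vtx i m.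
Proof.
move=> ne_ij le_m; rewrite permM slideV_vtx; last by lia.
by rewrite slide_other 1?eq_sym //; lia.
Qed.

Lemma loop_hub1 i j : i != j -> 0 < q i -> loop i j hub1 = final i.
Proof. by move=> ne_ij qi; rewrite permM slideV_hub1 slide_other 1?eq_sym ?qi ?leqnn. Qed.

Lemma loop_advance i j m : i != j -> 0 < m <= q j -> loop i j (vtx j m) = vtx j m.+1.
Proof. by move=> ne_ij le_m; rewrite permM slideV_other // slide_vtx //; lia. Qed.

Lemma loop_out i j k m : i != k -> j != k -> 0 < m <= q k -> loop i j (vtx k m) = vtx k m.
Proof. by move=> ne_ik ne_jk le_m; rewrite permM slideV_other // slide_other. Qed.

Lemma loop_hub0 i j : loop i j hub0 = hub0.
Proof. by rewrite permM slideV_hub0 slide_hub1. Qed.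

Lemma another (k : color) : exists j, j != k.
Proof. by case: k; [exists Mid | exists Lft | exists Lft]. Qed.

Lemma third (i k : color) : exists2 j, j != i & j != k.
Proof. by case: i k => [] []; (by exists Lft) || (by exists Mid) || (by exists Rgt). Qed.

Section Primitive.

Variable R : rel V.
Hypothesis R_refl : reflexive R.
Hypothesis R_sym : symmetric R.
Hypothesis R_trans :
  {in [set~ hub0] & &, forall x y z, R x y -> R y z -> R x z}.
Hypothesis R_inv : forall h x y, h \in H -> R x y -> R (h x) (h y).

Lemma inner_in_S k m : 0 < m <= q k -> vtx k m \in [set~ hub0].
Proof. by move=> le_m; rewrite !inE inner_neq_hub0. Qed.

Lemma hub1_in_S : hub1 \in [set~ hub0].
Proof. by rewrite !inE eq_sym hub_neq. Qed.

(** A loop that avoids path [k] fixes its vertices and moves the second hub along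
    the two other paths. *)
Lemma spread k m0 i m : i != k -> 0 < m0 <= q k -> 0 < m <= q i ->
  R (vtx k m0) hub1 -> R (vtx k m0) (vtx i m).
Proof.
move=> ne_ik le_m0 le_m R1; have [j ne_ji ne_jk] := third i k.
have move_R y : R (vtx k m0) y -> R (vtx k m0) (loop i j y).
  by move/(R_inv (H_loop i j)); rewrite loop_out.
(* Retreating from the second hub: induction on the distance [d] to the end. *)
have [d eq_q] : exists d, q i = m + d by exists (q i - m); lia.
have {le_m}m_gt0 : 0 < m by lia.
rewrite eq_sym in ne_ji; elim: d m m_gt0 eq_q => [|d IHd] m m_gt0 eq_q.
  have -> : m = q i by lia.
  by rewrite -(loop_hub1 ne_ji) ?move_R // eq_q; lia.
by rewrite -(loop_retreat ne_ji) ?move_R ?IHd //; lia.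
Qed.

Lemma reach_hub1 k m : 0 < m <= q k -> exists2 h, h \in H & h (vtx k m) = hub1.
Proof.
move=> le_m; have [j ne_jk] := another k.
have [d eq_q] : exists d, q k = m + d by exists (q k - m); lia.
elim: d m le_m eq_q => [|d IHd] m le_m eq_q.
  exists (loop j k); rewrite ?H_loop // loop_advance // -(vtx_end a b k).
  by congr vertex; lia.
have [|h Hh eq_h] := IHd m.+1 _ (etrans eq_q (addnS _ _)); first by lia.
exists (loop j k * h)%g; first exact: groupM (H_loop j k) Hh.
by rewrite permM loop_advance.
Qed.

(** The puzzle group is primitive.  A nontrivial pair can be moved so that it
    contains the second hub; its other member lies inside some path, and then
    [spread] fills the other two paths.  Applied once more from one of those, it
    fills the first path. *)
Lemma R_total : (exists x y, [/\ x \in [set~ hub0], y \in [set~ hub0], x != y & R x y]) ->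
  {in [set~ hub0] &, forall x y, R x y}.
Proof.
move=> [x [y [Sx Sy ne_xy Rxy]]].
have [k [m le_m R1]] : exists k, exists2 m, 0 < m <= q k & R (vtx k m) hub1.
  have [h Hh eq_hx] : exists2 h, h \in H & h x = hub1.
    move: Sx; rewrite !inE; case: (vtxP x) => [|_|k m le_m _]; first by rewrite eqxx.
      by exists 1%g; rewrite ?group1 ?perm1.
    exact: reach_hub1.
  have := R_inv Hh Rxy; rewrite R_sym eq_hx.
  have: h y != hub0 by rewrite -(H_hub0 Hh) (inj_eq perm_inj); rewrite !inE in Sy.
  have: h y != hub1 by rewrite -eq_hx (inj_eq perm_inj) eq_sym.
  case: (vtxP (h y)) => [_ /eqP // | /eqP // | k m le_m _ _ R1].
  by exists k, m.
have [i ne_iM ne_ik] := third Mid k.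
have qi : q i = a by case: (i) ne_iM.
have all_hub1 z : z \in [set~ hub0] -> R z hub1.
  rewrite !inE; case: (vtxP z) => [/eqP // | // | i' m' le_m' _].
  have [eq_ik' | ne_ik'] := eqVneq i' k; last first.
    apply: (R_trans (inner_in_S le_m') (inner_in_S le_m) hub1_in_S _ R1).
    by rewrite R_sym spread.
  have le_1 : 0 < 1 <= q i by rewrite qi.
  have R_i1 : R (first i) hub1.
    apply: (R_trans (inner_in_S le_1) (inner_in_S le_m) hub1_in_S _ R1).
    by rewrite R_sym spread.
  apply: (R_trans _ (inner_in_S le_1) hub1_in_S _ R_i1).
    by rewrite !inE inner_neq_hub0.
  by rewrite R_sym spread // eq_ik' eq_sym.
move=> u v Su Sv; apply: (R_trans Su hub1_in_S Sv); first exact: all_hub1.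
by rewrite R_sym all_hub1.
Qed.

End Primitive.

Lemma even_perms_in_loops x y z :
    x != hub0 -> y != hub0 -> z != hub0 -> x != y -> y != z -> x != z ->
    cycle3 x y z \in H ->
  forall h : {perm V}, h hub0 = hub0 -> ~~ odd_perm h -> h \in H.
Proof.
move=> ne_x ne_y ne_z ne_xy ne_yz ne_xz H_c h h0.
apply: (@even_perm_in_primitive _ H [set~ hub0] _ _ x y z); rewrite ?inE //.
- by move=> g v Hg; rewrite !inE -{2}(H_hub0 Hg) (inj_eq perm_inj).
- by move=> R R_refl R_sym R_trans R_inv; apply: R_total.
by apply/subsetP=> v; rewrite !inE; apply: contra => /eqP->; rewrite h0.
Qed.

Definition has_cycle3 := exists x y z : V,
  [/\ x != hub0, y != hub0 & z != hub0] /\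
  [/\ x != y, y != z, x != z & cycle3 x y z \in H].

Lemma cycle3_short_bridge : b = 0 -> has_cycle3.
Proof.
move=> b0; exists hub1, (first Rgt), (first Lft); split; split; try vneq.
by rewrite /cycle3 -(@double_tour_empty a b a_gt0 Lft Mid Rgt) // sweep_even.
Qed.

Lemma cycle3_short_side : a = 1 -> has_cycle3.
Proof.
move=> a1; exists hub1, (first Lft), (first Rgt); split; split; try vneq.
by rewrite /cycle3 -triangle // sweep_even.
Qed.

Let double i j k : i != j -> j != k -> i != k -> 0 < b ->
  (tperm (first i) (first k) * tperm hub1 (final j))%g \in H.
Proof.
move=> ne_ij ne_jk ne_ik b_gt0.
have qk l : 0 < q l by case: l.
by rewrite -double_tour // sweep_even.
Qed.

(** The three double transpositions given by [double_tour] generate a copy of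
    the symmetric group on the second hub and its three neighbours, acting in
    parallel on the neighbours of the first hub.  The double transpositions [w1H]
    and [w2H] of these four points alone lie in the kernel of that second action;
    turning one of them by a loop changes one of its four points, and
    the product with the other is a 3-cycle. *)
Lemma cycle3_long : 1 < a -> 1 < b -> has_cycle3.
Proof.
move=> a_gt1 b_gt1.
have [d1H d2H d3H] :
  [/\ (tperm (first Mid) (first Rgt) * tperm hub1 (final Lft))%g \in H,
      (tperm (first Lft) (first Rgt) * tperm hub1 (final Mid))%g \in H
    & (tperm (first Lft) (first Mid) * tperm hub1 (final Rgt))%g \in H].
  by split; apply: double => //; lia.
set d1 := (_ * _)%g in d1H; set d2 := (_ * _)%g in d2H; set d3 := (_ * _)%g in d3H.
set y := vtx Lft a.-1.
have w1H : (tperm (final Lft) (final Mid) * tperm hub1 (final Rgt))%g \in H.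
  have <- : (d2 ^ d1 * d3)%g = (tperm (final Lft) (final Mid) * tperm hub1 (final Rgt))%g.
    have [e1 e2 e3 e4] : [/\ d1 (first Lft) = first Lft, d1 (first Rgt) = first Mid,
                            d1 hub1 = final Lft & d1 (final Mid) = final Mid].
      split; rewrite permM.
      - by rewrite [tperm (first Mid) _ _]tpermD ?tpermD //; vneq.
      - by rewrite tpermR tpermD //; vneq.
      - by rewrite [tperm (first Mid) _ _]tpermD ?tpermL //; vneq.
      - by rewrite [tperm (first Mid) _ _]tpermD ?tpermD //; vneq.
    rewrite conjMg !tpermJ e1 e2 e3 e4 /d3 mulgA.
    rewrite (@tperm_commute _ (first Lft)); try vneq.
    by rewrite -(mulgA (tperm (final Lft) _)) tperm2 mulg1.
  by rewrite groupM ?groupJ.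
have w2H : (tperm (final Mid) (final Rgt) * tperm hub1 (final Lft))%g \in H.
  have <- : (d3 ^ d2 * d1)%g = (tperm (final Mid) (final Rgt) * tperm hub1 (final Lft))%g.
    have [e1 e2 e3 e4] : [/\ d2 (first Lft) = first Rgt, d2 (first Mid) = first Mid,
                            d2 hub1 = final Mid & d2 (final Rgt) = final Rgt].
      split; rewrite permM.
      - by rewrite tpermL tpermD //; vneq.
      - by rewrite [tperm (first Lft) _ _]tpermD ?tpermD //; vneq.
      - by rewrite [tperm (first Lft) _ _]tpermD ?tpermL //; vneq.
      - by rewrite [tperm (first Lft) _ _]tpermD ?tpermD //; vneq.
    rewrite conjMg !tpermJ e1 e2 e3 e4 /d1 mulgA (tpermC (first Rgt)).
    rewrite (@tperm_commute _ (first Mid)); try vneq.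
    by rewrite -(mulgA (tperm (final Mid) _)) tperm2 mulg1.
  by rewrite groupM ?groupJ.
have w3H : (tperm hub1 (final Rgt) * tperm (final Lft) y)%g \in H.
  have := groupJ w2H (H_loop Lft Mid); rewrite conjMg !tpermJ.
  rewrite loop_hub1 // loop_advance /= ?b_gt0 ?leqnn //; last by lia.
  rewrite loop_out ?a_gt0 ?leqnn // (vtx_end a b Mid).
  rewrite -[vtx Lft a]/(vtx Lft (q Lft)).
  have -> : final Lft = vtx Lft a.-1.+1 by congr vertex => /=; lia.
  by rewrite loop_retreat //=; lia.
exists (final Lft), (final Mid), y.
split; split; try by rewrite /y; vneq.
have -> : cycle3 (final Lft) (final Mid) y =
   (tperm (final Lft) (final Mid) * tperm hub1 (final Rgt)
     * (tperm hub1 (final Rgt) * tperm (final Lft) y))%g.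
  by rewrite mulgA -(mulgA (tperm (final Lft) _)) tperm2 mulg1.
by rewrite groupM.
Qed.

(** A double transposition and its conjugate under two turns of the outer circle
    share just one point, the only inner vertex of the middle path.  In the
    square of their product everything else cancels.  Two turns are needed
    to separate the transpositions [u] and [v]; there is no room for this if [a = 2]. *)
Lemma cycle3_wheel : 2 < a -> b = 1 -> has_cycle3.
Proof.
move=> a_gt2 b1; have b_gt0 : 0 < b by lia.
have dH : (tperm (first Lft) (first Rgt) * tperm hub1 (first Mid))%g \in H.
  have final_M : final Mid = first Mid by congr vertex; rewrite /= b1.
  by have := @double Lft Mid Rgt isT isT isT b_gt0; rewrite final_M.
set u := tperm (first Lft) _ in dH; set A := tperm hub1 _ in dH.
pose v := tperm (vtx Rgt 2) (vtx Rgt 3).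
pose y := vtx Lft a.-1; pose B := tperm y (first Mid).
have dgH : (v * B)%g \in H.
  have loopH := H_loop Lft Rgt.
  have loop_M : loop Lft Rgt (first Mid) = first Mid by rewrite loop_out ?b_gt0.
  have loop_L : loop Lft Rgt (first Lft) = first Rgt.
    by rewrite permM slideV_1 slide_hub0.
  have := groupJ dH loopH; rewrite conjMg !tpermJ loop_L loop_M.
  rewrite loop_hub1 // loop_advance ?a_gt0 //.
  have -> : final Lft = vtx Lft a.-1.+1 by congr vertex => /=; lia.
  move/groupJ/(_ loopH); rewrite conjMg !tpermJ loop_M.
  by rewrite !loop_advance ?loop_retreat //=; lia.
have uH : ((u * A * (v * B)) ^+ 2)%g \in H by rewrite groupX // groupM.
have sqA : (u ^+ 2 = 1 /\ v ^+ 2 = 1)%g by rewrite !expgS !expg0 !mulg1 !tperm2.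
have eq_sq : ((u * A * (v * B)) ^+ 2)%g = ((A * B) ^+ 2)%g.
  have uA : commute u A by apply: tperm_commute; vneq.
  have uB : commute u B by apply: tperm_commute; rewrite /y; vneq.
  have uv : commute u v by apply: tperm_commute; vneq.
  have vA : commute v A by apply: tperm_commute; vneq.
  have vB : commute v B by apply: tperm_commute; rewrite /y; vneq.
  have -> : (u * A * (v * B) = u * v * (A * B))%g.
    by rewrite !mulgA -(mulgA u A v) -vA mulgA.
  rewrite expgMn; last by apply/commute_sym/commuteM; apply/commute_sym/commuteM.
  by rewrite expgMn // sqA.1 sqA.2 !mul1g.
exists (first Mid), y, hub1; split; split; try by rewrite /y; vneq.
suff -> : cycle3 (first Mid) y hub1 = ((A * B) ^+ 2)%g by rewrite -eq_sq.
have -> : (A * B)%g = cycle3 (first Mid) hub1 y.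
  by rewrite /A /B tpermC [tperm y _]tpermC.
have [ne_M1 ne_My ne_1y] : [/\ first Mid != hub1, first Mid != y & hub1 != y].
  by split; rewrite /y; vneq.
apply: (mulgI (cycle3 (first Mid) hub1 y)); rewrite -expgS -(cycle3V (first Mid) hub1) mulgV.
by rewrite /cycle3 !expgS expg0 mulg1 mulgA tperm3_cube.
Qed.

Theorem puzzle_even (h : {perm V}) : (a, b) <> (2, 1) ->
  h hub0 = hub0 -> ~~ odd_perm h -> h \in H.
Proof.
move=> ne_21; have [x [y [z [[ne_x ne_y ne_z] [ne_xy ne_yz ne_xz H_c]]]]] : has_cycle3.
  have [b0 | b_gt0] := posnP b; first exact: cycle3_short_bridge.
  have [a1 | ne_a1] := eqVneq a 1; first exact: cycle3_short_side.
  have [b1 | ne_b1] := eqVneq b 1; last by apply: cycle3_long; lia.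
  apply: cycle3_wheel => //; case: (ltngtP a 2) => // [|a2]; first by lia.
  by case: ne_21; rewrite a2 b1.
exact: (even_perms_in_loops ne_x ne_y ne_z ne_xy ne_yz ne_xz H_c).
Qed.

(** If [a + b] is odd, a loop through the middle path is an odd permutation. *)
Theorem puzzle_all (h : {perm V}) : (a, b) <> (2, 1) -> odd (a + b) ->
  h hub0 = hub0 -> h \in H.
Proof.
move=> ne_21 odd_ab h0; have [odd_h | even_h] := boolP (odd_perm h); last exact: puzzle_even.
have odd_loop : odd_perm (loop Lft Mid).
  rewrite odd_permM odd_permV !odd_path_perm ?uniq_tpath // !size_tpath /=.
  by rewrite addNb addbN negbK -oddD.
rewrite -(groupMr _ (H_loop Lft Mid)); apply: puzzle_even => //.
  by rewrite permM h0 loop_hub0.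
by rewrite odd_permM odd_h odd_loop.
Qed.

End Puzzle.

(** * The generators of the two Cayley graphs *)

Section Symmetries.

Variables a b : nat.

Local Notation n := (theta_n a b).
Local Notation V := 'I_n.+1.
Local Notation q := (inner_size a b).
Local Notation vtx := (vertex a b).
Local Notation slide := (slide_perm a b).

Lemma rho_natE v : v <= 2 * a + b + 1 -> rho_nat a b v =
  if v <= a then v + a + 1 else if v <= 2 * a + 1 then v - (a + 1) else 4 * a + b + 3 - v.
Proof.
move=> le_v; rewrite /rho_nat; have [le_va | gt_va] := leqP v a.
  by rewrite modn_small; [case: ifP | ]; lia.
case: leqP => // le_v2; have -> : v + a + 1 = v - (a + 1) + (2 * a + 2) by lia.
by rewrite modnDr modn_small; lia.
Qed.

Lemma vtx_index_le k i : i <= (q k).+1 -> vertex_index a b k i <= 2 * a + b + 1.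
Proof. by case: k => /= le_i; repeat case: ifP; lia. Qed.

Lemma rho_vtx k i : 0 < a -> i <= (q k).+1 ->
  rho a b (vtx k i) = vtx (bar k) ((q k).+1 - i).
Proof.
move=> a_gt0 le_i; have q_bar : q (bar k) = q k by case: k {le_i}.
apply: val_inj => /=; rewrite permE rho_funE !vtxE ?q_bar ?leq_subr //.
rewrite rho_natE ?vtx_index_le //.
by case: k le_i {q_bar} => /= le_i; repeat case: ifP; lia.
Qed.

Lemma psi_vtx k i : 0 < a -> i <= (q k).+1 -> psi a b (vtx k i) = vtx k ((q k).+1 - i).
Proof.
move=> a_gt0 le_i; apply: val_inj => /=; rewrite permE psi_funE !vtxE ?leq_subr //.
by rewrite /psi_nat; case: k le_i => /= le_i; repeat case: ifP; lia.
Qed.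

Hypothesis a_gt0 : 0 < a.

(** Reversing a path inverts the cycle that it defines. *)
Lemma slide_reverse (s : {perm V}) k k' : q k' = q k ->
    (forall i, i <= (q k).+1 -> s (vtx k i) = vtx k' ((q k).+1 - i)) ->
  (slide k ^ s)%g = (slide k')^-1%g.
Proof.
move=> eq_q rev_s; rewrite /slide_perm -path_perm_map -path_perm_rev; congr path_perm.
apply: (@eq_from_nth _ (vtx Lft 0)) => [|i].
  by rewrite size_map size_rev !size_tpath eq_q.
rewrite size_map size_tpath => lt_i.
rewrite (nth_map (vtx Lft 0)) ?size_tpath // nth_tpath // rev_s //.
by rewrite nth_rev ?size_tpath eq_q // nth_tpath ?eq_q ?subSS ?leq_subr.
Qed.

Lemma slide_rho k : (slide k ^ rho a b)%g = (slide (bar k))^-1%g.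
Proof.
apply: slide_reverse => [|i le_i]; first by case: k.
exact: rho_vtx.
Qed.

Lemma slide_psi k : (slide k ^ psi a b)%g = (slide k)^-1%g.
Proof. by apply: slide_reverse => // i le_i; apply: psi_vtx. Qed.

End Symmetries.

Section Generators.

Variables a b : nat.
Hypothesis a_gt0 : 0 < a.

Local Notation n := (theta_n a b).
Local Notation V := 'I_n.+1.
Local Notation q := (inner_size a b).
Local Notation vtx := (vertex a b).
Local Notation slide := (slide_perm a b).
Local Notation sweep := (@word_perm a b).
Local Notation rho := (rho a b).
Local Notation psi := (psi a b).
Local Notation hub0 := (vtx Lft 0).
Local Notation hub1 := (vtx Lft a.+1).
Local Notation loop i j := ((slide i)^-1 * slide j)%g.

Definition sigma k := theta_sigma (tpath a b k).
Definition tau k := theta_tau (tpath a b k).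

Lemma hub0_ord0 : hub0 = ord0. Proof. exact: inord_ord0. Qed.

Lemma rhoV : rho^-1%g = rho.
Proof. by apply/permP=> v; apply: (@perm_inj _ rho); rewrite permKV !permE rho_funK. Qed.

Lemma psiV : psi^-1%g = psi.
Proof. by apply/permP=> v; apply: (@perm_inj _ psi); rewrite permKV !permE psi_funK. Qed.

Lemma rho_slide0 k : (rho * slide k)%g ord0 = ord0.
Proof.
by rewrite -hub0_ord0 permM rho_vtx // subn0 (vtx_end a b Rgt) slide_hub1.
Qed.

Lemma psi_slide0 k : (psi * slide k)%g ord0 = ord0.
Proof.
by rewrite -hub0_ord0 permM psi_vtx // subn0 slide_hub1.
Qed.

Lemma loop0 i j : loop i j ord0 = ord0.
Proof. by rewrite -hub0_ord0 loop_hub0. Qed.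

Lemma sigmaM i j : (sigma (bar i) * sigma j)%g = fix0_perm (loop i j).
Proof.
rewrite /sigma /theta_sigma /Defs.pcomp -fix0M ?rho_slide0 // mulgA; congr fix0_perm.
by rewrite -{1}rhoV -(mulgA _ _ rho) -conjgE slide_rho // barK.
Qed.

Lemma tauM i j : (tau i * tau j)%g = fix0_perm (loop i j).
Proof.
rewrite /tau /theta_tau /Defs.pcomp -fix0M ?psi_slide0 // mulgA; congr fix0_perm.
by rewrite -{1}psiV -(mulgA _ _ psi) -conjgE slide_psi.
Qed.

Lemma fix0_1 : fix0_perm (1 : {perm V})%g = 1%g.
Proof. by apply: (@mulgI _ (fix0_perm 1)); rewrite -fix0M ?perm1 // !mulg1. Qed.

Lemma sigmaV k : sigma (bar k) = (sigma k)^-1%g.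
Proof. by apply/eqP; rewrite eq_sym eq_invg_mul -{1}(barK k) sigmaM mulVg fix0_1. Qed.

Lemma tauV k : (tau k * tau k)%g = 1%g.
Proof. by rewrite tauM mulVg fix0_1. Qed.

Lemma slide_inj : injective slide.
Proof.
move=> i j eq_ij; have := slide_hub0 a b i; rewrite eq_ij slide_hub0 => eq_v.
have first_inj k l : k != Mid -> vtx k 1 = vtx l 1 -> k = l.
  move=> neM; case/inner_inj=> //; by case: k neM => //= _; rewrite a_gt0.
have [eq_iM | ] := eqVneq i Mid; last by move/first_inj; apply.
have [eq_jM | ] := eqVneq j Mid; last by move/first_inj/(_ eq_v).
by rewrite eq_iM eq_jM.
Qed.

Lemma sigma_inj : injective sigma.
Proof. by move=> i j /(fix0_inj (rho_slide0 i) (rho_slide0 j))/mulgI/slide_inj. Qed.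

Lemma tau_inj : injective tau.
Proof. by move=> i j /(fix0_inj (psi_slide0 i) (psi_slide0 j))/mulgI/slide_inj. Qed.

Lemma sigma_neq1 k : sigma k != 1%g.
Proof.
apply/eqP; rewrite -fix0_1 => /(fix0_inj (rho_slide0 k) (perm1 _)) eq_1.
have: (rho * slide k)%g (vtx Lft 1) = vtx Lft 1 by rewrite eq_1 perm1.
have le_1 : 0 < 1 <= q Lft by [].
rewrite permM rho_vtx // subSS subn0; have [-> | ne_k] := eqVneq k Rgt.
  by move/eqP; rewrite slide_vtx // -[a.+1]/(q Rgt).+1 vtx_end eq_sym; apply/negP/inner_neq_hub1.
by rewrite slide_other //= ?a_gt0 ?leqnn // => /inner_inj[] //=; rewrite ?a_gt0 ?leqnn.
Qed.

Lemma theta_S1E : theta_S1 a b = [set sigma Lft; sigma Mid; sigma Rgt].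
Proof. by []. Qed.

Lemma sweep0 w : ~~ odd (size w) -> sweep false w ord0 = ord0.
Proof.
have [m] := ubnP (size w); elim: m w => // m IHm [|i [|j w]] //= le_w.
  by rewrite perm1.
by rewrite negbK => even_w; rewrite mulgA permM loop0 IHm //; lia.
Qed.

End Generators.

Section Parity.

Variables a b : nat.
Hypothesis (a_gt0 : 0 < a) (even_a : ~~ odd a) (b_div4 : 4 %| b).

Local Notation n := (theta_n a b).
Local Notation V := 'I_n.+1.
Local Notation q := (inner_size a b).
Local Notation vtx := (vertex a b).

(** The involution moves every vertex, as all three paths have an odd number of
    edges.  It has [a + 1 + b / 2] transpositions. *)
Lemma odd_reflection (s : {perm V}) (c : color -> color) :
    (forall v, s (s v) = v) -> (forall k, q (c k) = q k) ->
    (forall k i, i <= (q k).+1 -> s (vtx k i) = vtx (c k) ((q k).+1 - i)) ->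
  odd_perm s.
Proof.
move=> sK q_c rev_s; rewrite odd_involution //.
  rewrite card_ord -[n.+1]/((2 * a + b + 1).+1).
  by case/dvdnP: b_div4 even_a => m ->; lia.
have s_hub0 : s (vtx Lft 0) = vtx Lft a.+1.
  by rewrite rev_s // subn0 -(q_c Lft) vtx_end.
move=> v; case: (vtxP v) => [||k i le_i].
- by rewrite s_hub0 eq_sym hub_neq.
- by rewrite -s_hub0 sK s_hub0 hub_neq.
have even_q : ~~ odd (q k) by case: (k) => //=; case/dvdnP: b_div4 => m ->; lia.
rewrite rev_s; last by lia.
by apply/eqP=> /inner_inj[||_]; rewrite ?q_c; lia.
Qed.

Lemma even_sigma k : ~~ odd_perm (sigma a b k).
Proof.
rewrite odd_fix0 ?rho_slide0 // odd_permM odd_path_perm ?uniq_tpath // size_tpath.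
have -> : odd_perm (rho a b).
  apply: (@odd_reflection _ bar) => [v|[]|k' i le_i] //; last exact: rho_vtx.
  by rewrite !permE rho_funK.
by case: k => /=; rewrite ?negbK; case/dvdnP: b_div4 => m eq_b; lia.
Qed.

Lemma even_tau k : ~~ odd_perm (tau a b k).
Proof.
rewrite odd_fix0 ?psi_slide0 // odd_permM odd_path_perm ?uniq_tpath // size_tpath.
have -> : odd_perm (psi a b).
  apply: (@odd_reflection _ id) => [v||k' i le_i] //; last exact: psi_vtx.
  by rewrite !permE psi_funK.
by case: k => /=; rewrite ?negbK; case/dvdnP: b_div4 => m eq_b; lia.
Qed.

End Parity.

(** * An isomorphism would be rigid, and rigidity is impossible *)

Section Isomorphism.

Variables a b : nat.
Hypothesis a_gt0 : 0 < a.
Variable G : {group 'S_(theta_n a b)}.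

Local Notation sigma := (@sigma a b).
Local Notation tau := (@tau a b).
Local Notation sweep := (@word_perm a b).
Local Notation slide := (slide_perm a b).
Local Notation rho := (Defs.rho a b).
Local Notation loop i j := ((slide i)^-1 * slide j)%g.

Hypothesis (G_sigma : forall k, sigma k \in G) (G_tau : forall k, tau k \in G).

Variable f : [subg G] -> [subg G].
Hypothesis f_inj : injective f.
Hypothesis f_iso : forall x y,
  cayley G (theta_S2 a b) (f x) (f y) = cayley G (theta_S1 a b) x y.

Let s k := subg G (sigma k).
Let t k := subg G (tau k).

Let val_mul (g h : [subg G]) : sgval (g * h)%g = (sgval g * sgval h)%g.
Proof. by apply: sgvalM; rewrite inE. Qed.

Let val_inv (g : [subg G]) : sgval g^-1%g = (sgval g)^-1%g.
Proof. by apply: (morphV (sgval_morphism G)); rewrite inE. Qed.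

Let s_val k : sgval (s k) = sigma k. Proof. exact: (subgK _ (G_sigma k)). Qed.
Let t_val k : sgval (t k) = tau k. Proof. exact: (subgK _ (G_tau k)). Qed.

Lemma cayley_edge g k : cayley G (theta_S1 a b) g (s k * g)%g.
Proof.
apply/exists_inP; exists (sigma k); first by rewrite !inE; case: k; rewrite eqxx ?orbT.
by rewrite -s_val /Defs.pcomp val_mul.
Qed.

Lemma iso_edge g k : exists j, f (s k * g)%g = (t j * f g)%g.
Proof.
have := cayley_edge g k; rewrite -f_iso => /exists_inP[h S2h /eqP eq_h].
have [j def_h] : exists j, h = tau j.
  by move: S2h; rewrite !inE -orbA => /or3P[] /eqP->; [exists Lft | exists Mid | exists Rgt].
by exists j; apply: subg_inj; rewrite eq_h def_h val_mul t_val.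
Qed.

Lemma s_inj : injective s.
Proof. by move=> i j eq_ij; apply: (@sigma_inj a b a_gt0); rewrite -(s_val i) -(s_val j) eq_ij. Qed.

Lemma t_inj : injective t.
Proof. by move=> i j eq_ij; apply: (@tau_inj a b a_gt0); rewrite -(t_val i) -(t_val j) eq_ij. Qed.

Lemma s_inv k : s (bar k) = (s k)^-1%g.
Proof. by apply: subg_inj; rewrite val_inv !s_val sigmaV. Qed.

Lemma t_inv k : (t k * t k = 1)%g.
Proof. by apply: subg_inj; rewrite val_mul !t_val tauV. Qed.

(** Walks multiply on the left, hence the inverse. *)
Lemma walk_val w g : ~~ odd (size w) ->
  sgval (walk s false w g) = (fix0_perm (sweep false w)^-1 * sgval g)%g.
Proof.
have [m] := ubnP (size w); elim: m w g => // m IHm [|i [|j w]] g //= le_w.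
  by rewrite invg1 fix0_1 mul1g.
rewrite negbK => even_w; have w0 : sweep false w ord0 = ord0 by apply: sweep0.
have wV0 : (sweep false w)^-1%g ord0 = ord0 by rewrite -{1}w0 permK.
rewrite IHm //; last by lia.
have -> : ((slide i)^-1 * (slide j * sweep false w))^-1%g = ((sweep false w)^-1 * loop j i)%g.
  by rewrite !invMg invgK mulgA.
by rewrite fix0M ?loop0 // !val_mul !s_val -sigmaM // !mulgA.
Qed.

Lemma twalk_val w g : ~~ odd (size w) ->
  sgval (twalk t w g) = (fix0_perm (sweep false w)^-1 * sgval g)%g.
Proof.
have [m] := ubnP (size w); elim: m w g => // m IHm [|i [|j w]] g //= le_w.
  by rewrite invg1 fix0_1 mul1g.
rewrite negbK => even_w; have w0 : sweep false w ord0 = ord0 by apply: sweep0.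
have wV0 : (sweep false w)^-1%g ord0 = ord0 by rewrite -{1}w0 permK.
rewrite IHm //; last by lia.
have -> : ((slide i)^-1 * (slide j * sweep false w))^-1%g = ((sweep false w)^-1 * loop j i)%g.
  by rewrite !invMg invgK mulgA.
by rewrite fix0M ?loop0 // !val_mul !t_val -tauM // !mulgA.
Qed.

Lemma rel_walk w g : ~~ odd (size w) -> is_relator a b w -> walk s false w g = g.
Proof.
move=> even_w /eqP rel_w; apply: subg_inj.
by rewrite walk_val // rel_w invg1 fix0_1 mul1g.
Qed.

Lemma rel_twalk w h : ~~ odd (size w) -> twalk t w h = h -> is_relator a b w.
Proof.
move=> even_w /(congr1 sgval); rewrite twalk_val // -{2}[sgval h]mul1g -fix0_1 => /mulIg.
have wV0 : (sweep false w)^-1%g ord0 = ord0 by rewrite -{1}(@sweep0 a b a_gt0 w even_w) permK.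
by move/(fix0_inj wV0 (perm1 _))/eqP; rewrite -eq_invg1 invgK.
Qed.

Local Notation rigid := (rigid s t f).

(** The subgroup given by [rigid_proper] contains the puzzle group, which
    contains [sigma Lft]. *)
Lemma iso_not_rigid : (a, b) <> (2, 1) ->
  odd (a + b) || ~~ odd_perm (sigma Lft) -> ~ rigid.
Proof.
move=> ne_21 even_ab /rigid_proper[|||K K_ss K's].
- exact: s_inj.
- exact: f_inj.
- exact: iso_edge.
pose H := [set h : {perm 'I_(theta_n a b).+1} | (h ord0 == ord0) && (fix0_perm h \in sgval @* K)%g].
have groupH : group_set H.
  apply/group_setP; split; first by rewrite inE perm1 eqxx fix0_1 group1.
  move=> g h; rewrite !inE => /andP[/eqP g0 Kg] /andP[/eqP h0 Kh].
  by rewrite permM g0 h0 eqxx fix0M // groupM.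
have H_loop i j : loop i j \in Group groupH.
  rewrite inE loop0 eqxx -sigmaM // -!s_val -val_mul; apply: mem_morphim; rewrite ?inE //.
  exact: K_ss.
have H_hub0 h : h \in Group groupH -> h (vertex a b Lft 0) = vertex a b Lft 0.
  by rewrite inE hub0_ord0 => /andP[/eqP].
suff: (rho * slide Lft)%g \in Group groupH.
  rewrite inE => /andP[_ /morphimP[x _ Kx]]; rewrite -[fix0_perm _]/(sigma Lft) -s_val.
  by move/subg_inj=> def_x; rewrite def_x Kx in K's.
have rs0 : (rho * slide Lft)%g (vertex a b Lft 0) = vertex a b Lft 0.
  by rewrite hub0_ord0 rho_slide0.
case/orP: even_ab => [odd_ab | even_s]; first exact: (puzzle_all a_gt0 H_loop H_hub0).
by apply: (puzzle_even a_gt0 H_loop H_hub0) => //; rewrite -odd_fix0 ?rho_slide0.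
Qed.

Lemma iso_rigid : detectable a b -> rigid.
Proof.
exact: (rigid_of_detectable a_gt0 t_inj s_inj f_inj s_inv t_inv iso_edge rel_walk rel_twalk).
Qed.

End Isomorphism.

(** * Recognising colours by short relators *)

Section Detection.

Variables a b : nat.
Hypothesis a_gt0 : 0 < a.

Local Notation sizes x y := (inner_size x y).

Lemma spins_close4 : 0 < b -> spins_close a b 4.
Proof.
move=> b_gt0 i j k ne_ij ne_jk ne_ik; apply/and3P; split=> //; last exact: spin4_rel.
by case: i j k ne_ij ne_jk ne_ik => [] [] [].
Qed.

Lemma spins_close6 : b = 0 -> spins_close a b 6.
Proof.
move=> b0 i j k ne_ij ne_jk ne_ik; apply/and3P; split=> //; last exact: spin6_rel.
by case: i j k ne_ij ne_jk ne_ik => [] [] [].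
Qed.

Lemma fits_sizes Qa Qb Da Db :
    (Da = 0 /\ Qa = a) \/ (0 < Da < Qa /\ Qa <= a) ->
    (Db = 0 /\ Qb = b) \/ (0 < Db < Qb /\ Qb <= b) ->
  fits_model a b (sizes Qa Qb) (sizes Da Db).
Proof. by move=> fit_a fit_b []. Qed.

End Detection.

(** If [b = 0], the spins have length 18, and the model of size 9 with a guard
    behind the second vertex covers all [a >= 9].  Smaller sizes are treated one
    by one at the length of the ladders, which for [a = 8] is again 18. *)
Lemma no_circuit_bridge0 : no_circuit (inner_size 9 0) (inner_size 2 0) returns 9.
Proof. by vm_compute. Qed.

Lemma no_circuit_bridge0_8 : no_circuit (inner_size 8 0) (inner_size 0 0) zigzags 9.
Proof. by vm_compute. Qed.

Lemma no_circuit_bridge0_small :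
  all (fun x => no_circuit (inner_size x 0) (inner_size 0 0) avoids_mid x.+1) (iota 2 6).
Proof. by vm_compute. Qed.

Lemma no_circuit_sum5 :
  all (fun x => no_circuit (inner_size x (5 - x)) (inner_size 0 0) zigzags 6) (iota 2 3).
Proof. by vm_compute. Qed.

(** If [a = 1], the outer circle has only three tiles, and turning it
    three times is the only relator of length 6, up to its starting point. *)
Lemma detectable_side1 b : 1 < b -> detectable 1 b.
Proof.
move=> b_gt1; apply: DetectByHexagon => [|w].
  by apply/and3P; split=> //; apply: hexagon_rel.
have fit : fits_model 1 b (inner_size 1 2) (inner_size 0 1).
  by apply: fits_sizes; [left | right].
have no_circ : no_circuit (inner_size 1 2) (inner_size 0 1) (fun i j k => ~~ avoids_mid i j k) 3.
  by vm_compute.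
move=> circ_w; have := @no_circuit_sound 1 b _ _ _ 3 _ fit isT no_circ circ_w.
by case/and3P: circ_w => /eqP; case: w => [|i [|j [|k w]]] //= _ _ _; rewrite negbK.
Qed.

Lemma detectable_bridge0 a : 1 < a -> detectable a 0.
Proof.
move=> a_gt1; have [le_a7 | gt_a7] := leqP a 7.
  apply: DetectByLadder => w; rewrite addn0 addn1.
  have fit : fits_model a 0 (inner_size a 0) (inner_size 0 0).
    by apply: fits_sizes; left.
  apply: (no_circuit_sound fit); first by rewrite ltnS.
  by apply: (allP no_circuit_bridge0_small); rewrite mem_iota; lia.
have [-> | ne_a8] := eqVneq a 8.
  have fit : fits_model 8 0 (inner_size 8 0) (inner_size 0 0).
    by apply: fits_sizes; left.
  apply: (@DetectByZigzag 8 0 6); [by [] | by [] | exact: spins_close6 | move=> w].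
  exact: (@no_circuit_sound 8 0 _ _ _ 9 _ fit isT no_circuit_bridge0_8).
have fit : fits_model a 0 (inner_size 9 0) (inner_size 2 0).
  by apply: fits_sizes; [right; lia | left].
apply: (@DetectByReturn a 0 6); [by [] | by [] | exact: spins_close6 (ltnW a_gt1) _ | move=> w].
exact: (@no_circuit_sound a 0 _ _ _ 9 _ fit isT no_circuit_bridge0).
Qed.


(** If [a + b = 5], ladders have length 12, the same as the spins. *)
Lemma detectable_sum5 a b : 1 < a -> 0 < b -> a + b = 5 -> detectable a b.
Proof.
move=> a_gt1 b_gt0 sum5; have eq_b : b = 5 - a by lia.
have fit : fits_model a b (inner_size a b) (inner_size 0 0) by apply: fits_sizes; left.
have size5 : (a + b + 1).*2 = 4 * 3 by rewrite sum5.
apply: (@DetectByZigzag a b 4); [by [] | by [] | exact: spins_close4 (ltnW a_gt1) b_gt0 | move=> w].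
rewrite sum5; apply: (@no_circuit_sound a b _ _ _ 6 _ fit isT).
by rewrite eq_b; apply: (allP no_circuit_sum5); rewrite mem_iota; lia.
Qed.

Lemma detectable_generic a b : 1 < a -> 0 < b ->
  [|| (4 < a) && (b == 1), (3 < a) && (b == 2), (a == 2) && (3 < b), (a == 3) && (2 < b),
      (3 < a) && (b == 3) | (3 < a) && (3 < b)] -> detectable a b.
Proof.
move=> a_gt1 b_gt0 range_ab; have a_gt0 := ltnW a_gt1.
apply: (@DetectByReturn a b 4); [by [] | by [] | exact: spins_close4 | ].
have sound Qa Qb Da Db :
    (Da = 0 /\ Qa = a) \/ (0 < Da < Qa /\ Qa <= a) ->
    (Db = 0 /\ Qb = b) \/ (0 < Db < Qb /\ Qb <= b) ->
    no_circuit (inner_size Qa Qb) (inner_size Da Db) returns 6 ->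
  forall w, circuit a b (4 * 3) w -> ~~ prefix3 returns w.
  move=> fit_a fit_b no_circ w.
  exact: (@no_circuit_sound a b _ _ _ 6 _ (fits_sizes fit_a fit_b)).
(* In each range the guarded sizes stand for all larger ones. *)
case/or4P: range_ab => [/andP[a5 /eqP b1] | /andP[a4 /eqP b2] | /andP[/eqP a2 b4] |].
- by apply: (sound 5 1 1 0); [right | left | vm_compute].
- by apply: (sound 4 2 1 0); [right | left | vm_compute].
- by apply: (sound 2 4 0 1); [left | right | vm_compute].
case/or3P=> [/andP[/eqP a3 b3] | /andP[a4 /eqP b3] | /andP[a4 b4]].
- by apply: (sound 3 3 0 1); [left | right | vm_compute].
- by apply: (sound 4 3 1 0); [right | left | vm_compute].
by apply: (sound 4 4 1 1); [right | right | vm_compute].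
Qed.

Theorem theta_detectable a b : 0 < a ->
    (a, b) <> (1, 0) -> (a, b) <> (2, 1) ->
    odd (a + b) || ~~ odd a && (4 %| b) ->
  detectable a b.
Proof.
move=> a_gt0 ne_10 ne_21 parity.
have [a1 | ne_a1] := eqVneq a 1.
  rewrite a1 in ne_10 parity *; apply: detectable_side1.
  by case: b ne_10 parity {ne_21} => [|[|b]].
have a_gt1 : 1 < a by lia.
have [-> | b_gt0] := posnP b; first exact: detectable_bridge0.
have [sum5 | ne_sum5] := eqVneq (a + b) 5; first exact: detectable_sum5.
apply: detectable_generic => //.
have ne3 : a + b != 3 by apply/eqP=> sum3; case: ne_21; congr pair; lia.
by lia.
Qed.

(** * The two Cayley graphs are not isomorphic *)

(** The middle path is a single edge, and [psi] just exchanges its ends. *)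
Lemma tau_mid1 a b : a = 1 -> b = 0 -> tau a b Mid = 1%g.
Proof.
move=> a1 b0; have a_gt0 : 0 < a by rewrite a1.
rewrite -fix0_1; congr fix0_perm; apply/permP=> v; rewrite perm1 permM.
case: (vtxP v) => [||k i le_i].
- by rewrite psi_vtx // subn0 vtx_end slide_hub1.
- rewrite -{1}(vtx_end a b Mid) psi_vtx // subnn vtx0 slide_hub0 -(vtx_end a b Mid).
  by congr vertex; rewrite /= b0.
have neM : Mid != k by case: k le_i => //=; lia.
have qk : inner_size a b k = 1 by case: k neM {le_i}.
have -> : i = 1 by lia.
by rewrite psi_vtx // qk slide_other ?qk.
Qed.

Theorem theorem7 (a b : nat) (G : {group 'S_(theta_n a b)}) (a_ge1 : 1 <= a)
    (hG : [/\ odd (a + b), (a, b) <> (2, 1)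
            & G :=: ('Sym_('I_(theta_n a b)))%g]
       \/ [/\ ~~ odd a, 4 %| b & G :=: ('Alt_('I_(theta_n a b)))%g]) :
  ~ digraph_iso (cayley G (theta_S1 a b)) (cayley G (theta_S2 a b)).
Proof.
have [G_sigma G_tau] : (forall k, sigma a b k \in G) /\ (forall k, tau a b k \in G).
  case: hG => [[_ _ ->] | [even_a b_div4 ->]]; split=> k; rewrite ?Alt_even.
  - by rewrite inE.
  - by rewrite inE.
  - exact: even_sigma.
  exact: even_tau.
have ne_21 : (a, b) <> (2, 1).
  by case: hG => [[] // | [_ b_div4 _] [_ eq_b]]; rewrite eq_b in b_div4.
have parity : odd (a + b) || ~~ odd a && (4 %| b).
  by case: hG => [[->] // | [-> ->]]; rewrite orbT.
have even_ab : odd (a + b) || ~~ odd_perm (sigma a b Lft).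
  by case: hG => [[->] // | [even_a b_div4 _]]; rewrite even_sigma ?orbT.
case=> f [f_inv fK f_invK] f_iso; have f_inj := can_inj fK.
(* If [(a, b) = (1, 0)], the generator [tau Mid] makes a loop in the second graph. *)
have [eq_10 | ne_10] := eqVneq (a, b) (1, 0); last first.
  apply: (iso_not_rigid a_ge1 G_sigma G_tau f_inj f_iso ne_21 even_ab).
  apply: (iso_rigid a_ge1 G_sigma G_tau f_inj f_iso).
  by apply: theta_detectable => //; apply/eqP.
case: eq_10 => eq_a eq_b; move: (f_iso 1%g 1%g) => loop1.
have loop2 : cayley G (theta_S2 a b) (f 1%g) (f 1%g).
  apply/exists_inP; exists (tau a b Mid); first by rewrite !inE eqxx ?orbT.
  have -> : tau a b Mid = 1%g by apply: tau_mid1.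
  by rewrite /Defs.pcomp mul1g.
move: loop2; rewrite loop1 => /exists_inP[h S1h /eqP].
rewrite /Defs.pcomp morph1 mulg1 => def_h.
have ne_1 k : (1%g == sigma a b k) = false by rewrite eq_sym (negPf (sigma_neq1 b a_ge1 k)).
by move: S1h; rewrite -def_h theta_S1E !inE !ne_1.
Qed.
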